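(* For every integer $k \geq 0$, the neighborhood complex $\mathcal{N}(KG_{2,k})$ of the Kneser graph $KG_{2,k}$ is homotopy equivalent to the wedge of $k^2+5k+5$ copies of the $k$-sphere $S^k$.
   Context: Let $[n]=\{1,\dots,n\}$. The Kneser graph $KG_{2,k}$ has as vertices the 2-element subsets $\{i,j\}$ ($i\neq j$) of $[k+4]$, and two vertices $v_1,v_2$ are adjacent if and only if $v_1\cap v_2=\emptyset$. The neighborhood complex $\mathcal{N}(G)$ of a graph $G$ is the abstract simplicial complex whose vertices are the non-isolated vertices of $G$ and whose simplices are the subsets of $V(G)$ having a common neighbor in $G$. Homotopy equivalence refers to its geometric realization. *)

(* Defs.v *)
From HB Require Import structures.
From mathcomp Require Import all_boot all_order all_algebra.
From mathcomp Require Import boolp classical_sets functions reals topology.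
From mathcomp Require Import normedtype homotopy.

Set Implicit Arguments.
Unset Strict Implicit.
Unset Printing Implicit Defensive.

Import Order.TTheory GRing.Theory Num.Theory.
Import numFieldNormedType.Exports.

Local Open Scope classical_set_scope.
Local Open Scope ring_scope.

Record sgraph : Type := SGraph {
  gvertex :> finType;
  adj : rel gvertex;
  adj_sym : symmetric adj;
  adj_irr : irreflexive adj
}.

Definition kneser2_vertex (k : nat) : finType :=
  {A : {set 'I_(k + 4)} | #|A| == 2%N}.

Definition kneser2_adj (k : nat) : rel (kneser2_vertex k) :=
  fun A B => val A :&: val B == finset.set0.

Lemma kneser2_adj_sym (k : nat) : symmetric (@kneser2_adj k).
Proof. by move=> A B; rewrite /kneser2_adj finset.setIC. Qed.

Lemma kneser2_adj_irr (k : nat) : irreflexive (@kneser2_adj k).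
Proof.
move=> A; rewrite /kneser2_adj finset.setIid -cards_eq0.
by rewrite (eqP (valP A)).
Qed.

Definition KG2 (k : nat) : sgraph :=
  SGraph (@kneser2_adj_sym k) (@kneser2_adj_irr k).

(* The ambient type V may be larger than the vertex set; the empty set is
   allowed, but not required, to be a simplex. *)
Record simplicial_complex (V : finType) : Type := SimplicialComplex {
  vertices : {set V};
  simplices : {set {set V}};
  simplex_sub_vertices : forall A, A \in simplices -> A \subset vertices;
  simplex1 : forall v, v \in vertices -> [set v]%SET \in simplices;
  simplexS : forall A B : {set V},
    A \subset B -> B \in simplices -> A \in simplices
}.

Definition nonisolated (G : sgraph) : {set G} :=
  [set v : G | [exists w, adj v w]]%SET.

Definition common_nbr_sets (G : sgraph) : {set {set G}} :=
  [set A : {set G} | [exists w, [forall v in A, adj v w]]]%SET.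

Lemma common_nbr_sub (G : sgraph) (A : {set G}) :
  A \in common_nbr_sets G -> A \subset nonisolated G.
Proof.
rewrite inE => /existsP[w /forall_inP Aw]; apply/fintype.subsetP => v vA.
by rewrite inE; apply/existsP; exists w; exact: Aw.
Qed.

Lemma common_nbr1 (G : sgraph) (v : G) :
  v \in nonisolated G -> [set v]%SET \in common_nbr_sets G.
Proof.
rewrite !inE => /existsP[w vw]; apply/existsP; exists w.
by apply/forall_inP => u; rewrite inE => /eqP ->.
Qed.

Lemma common_nbrS (G : sgraph) (A B : {set G}) :
  A \subset B -> B \in common_nbr_sets G -> A \in common_nbr_sets G.
Proof.
move=> /fintype.subsetP AB; rewrite !inE => /existsP[w /forall_inP Bw].
by apply/existsP; exists w; apply/forall_inP => v /AB; exact: Bw.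
Qed.

Definition nbhd_complex (G : sgraph) : simplicial_complex G :=
  SimplicialComplex (@common_nbr_sub G) (@common_nbr1 G) (@common_nbrS G).

(* Points are given by barycentric coordinates. As V is finite, the subspace
   topology of R^V is the usual (weak) topology of the realization. *)
Definition realization_set (R : realType) (V : finType)
    (K : simplicial_complex V) : set {ptws V -> R} :=
  [set x | [/\ forall v, 0 <= x v,
               \sum_(v : V) x v = 1 &
               [set v : V | x v != 0]%SET \in simplices K]].

Definition realization (R : realType) (V : finType)
    (K : simplicial_complex V) : topologicalType :=
  set_type (@realization_set R V K).

(* The norm that the library puts on 'rV[R]_k.+1 is the sup norm, hence the
   explicit Euclidean equation. *)
Definition sphere_set (R : realType) (k : nat) : set 'rV[R]_k.+1 :=
  [set x | \sum_(i < k.+1) x ord0 i ^+ 2 = 1].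

Definition sphere (R : realType) (k : nat) : topologicalType :=
  set_type (@sphere_set R k).

Lemma sphere_base_subproof (R : realType) (k : nat) :
  (delta_mx ord0 ord0 : 'rV[R]_k.+1) \in @sphere_set R k.
Proof.
rewrite inE /sphere_set /= (bigD1 ord0) //= big1 => [|i /negPf i0].
  by rewrite mxE !eqxx expr1n addr0.
by rewrite mxE i0 andbF expr0n.
Qed.

Definition sphere_base (R : realType) (k : nat) : sphere R k :=
  exist (fun x => x \in @sphere_set R k) _ (sphere_base_subproof R k).

Definition sphere_wedge (R : realType) (k m : nat) : topologicalType :=
  wedge (fun _ : 'I_m => sphere_base R k).

Definition homotopic (R : realType) (X Y : topologicalType) (f g : X -> Y) :
    Prop :=
  exists H : X * R -> Y,
    [/\ {within [set: X] `*` [set t : R | 0 <= t <= 1], continuous H},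
        forall x, H (x, 0) = f x &
        forall x, H (x, 1) = g x].

Definition homotopy_equivalent (R : realType) (X Y : topologicalType) : Prop :=
  exists (f : X -> Y) (g : Y -> X),
    [/\ continuous f, continuous g,
        homotopic R (g \o f) idfun & homotopic R (f \o g) idfun].

(* Main.v *)
(* A point of the neighbourhood complex weighs the edges of a graph on [n],
   n = k + 4, that misses two points. Giving each point of [n] the largest weight
   of an edge at it, and dividing by the largest weight of all, gives a homotopy
   equivalence with the k-dimensional cubical complex of the points of the cube
   [0,1]^n that have two coordinates 0 and two coordinates 1; the weight of {i, j}
   in the inverse is proportional to y_i y_j.

   Call slab(a, b) the complex of the points of a cube with at least a zeros and
   b ones. By its last coordinate, slab(a, b) is the union of slab(a, b-1) x 1,
   slab(a-1, b) x 0 and slab(a, b) x [0,1], which meet in copies of slab(a, b). So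
   a contractible subcomplex with only top-dimensional open cells in its
   complement can be found by induction: it is glued from three smaller ones along
   contractible pieces. Collapsing it leaves a wedge of spheres, one for each of
   the omitted (critical) cells. Their numbers c(n; a, b) satisfy
   c(n+1; a, b) = c(n; a-1, b) + c(n; a, b-1) + c(n; a, b), so that
   c(k+4; 2, 2) = k^2 + 5k + 5. *)
From HB Require Import structures.
Require Import Defs.
From mathcomp Require Import all_boot all_order all_algebra.
From mathcomp Require Import boolp classical_sets functions filter reals topology.
From mathcomp Require Import normedtype homotopy.
From mathcomp Require Import ring lra zify.

Set Implicit Arguments.
Unset Strict Implicit.
Unset Printing Implicit Defensive.

Import Order.TTheory GRing.Theory Num.Theory.
Import numFieldNormedType.Exports.

Local Open Scope classical_set_scope.
Local Open Scope ring_scope.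

(** * Continuity on a subset *)

Section ContinuousOn.
Variables X Y : topologicalType.

(** Continuity relative to [A] of a total function, so that maps can be restricted, composed and
    pasted without changing types. *)
Definition cts_on (A : set X) (f : X -> Y) : Prop :=
  forall x, A x -> f @ within A (nbhs x) --> f x.

Lemma continuous_cts_on (A : set X) (f : X -> Y) : continuous f -> cts_on A f.
Proof. by move=> cf x _; apply: cvg_trans (cf x); apply: cvg_app; exact: cvg_within. Qed.

Lemma cts_onT (f : X -> Y) : cts_on setT f -> continuous f.
Proof.
by move=> cf x U /(cf x I) h; apply: filterS (h : nbhs x _) => y; exact.
Qed.

Lemma cts_onP (A : set X) (f : X -> Y) :
  cts_on A f <-> forall x (U : set Y), A x -> nbhs (f x) U ->
    \forall y \near x, A y -> U (f y).
Proof. by split=> [cf x U Ax Ux|cf x Ax U Ux]; [exact: cf|exact: cf]. Qed.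

Lemma cts_onS (A B : set X) (f : X -> Y) :
  A `<=` B -> cts_on B f -> cts_on A f.
Proof.
move=> AB /cts_onP cf; apply/cts_onP => x U Ax Ux.
by apply: filterS (cf x U (AB _ Ax) Ux) => y By /AB.
Qed.

Lemma eq_cts_on (A : set X) (f g : X -> Y) :
  (forall x, A x -> f x = g x) -> cts_on A f -> cts_on A g.
Proof.
move=> fg /cts_onP cf; apply/cts_onP => x U Ax; rewrite -fg// => Ux.
by apply: filterS (cf x U Ax Ux) => y By Ay; rewrite -fg//; exact: By.
Qed.

(** Pasting along a finite closed cover: near x the pieces that miss x can be avoided, their
    complements being open, and the other pieces contain x, so that continuity on them applies. *)
Lemma cts_on_cover (J : finType) (C : J -> set X) (A : set X) (f : X -> Y) :
  (forall j, closed (C j)) -> (forall x, A x -> exists j, C j x) ->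
  (forall j, cts_on (A `&` C j) f) -> cts_on A f.
Proof.
move=> clC AC cf; apply/cts_onP => x U Ax Ux.
have : \forall y \near x, forall j, (C j y -> A y -> U (f y)).
  apply: filter_forall => j; have [Cx|Cx] := pselect (C j x).
    have /cts_onP cfj := cf j.
    by apply: filterS (cfj x U (conj Ax Cx) Ux) => y Uy Cy Ay; exact: Uy.
  have /closed_openC oC := clC j.
  by apply: filterS (open_nbhs_nbhs (conj oC Cx)) => y nC /nC.
by apply: filterS => y Uy Ay; have [j Cy] := AC y Ay; exact: Uy Cy Ay.
Qed.

End ContinuousOn.

Lemma cts_on_comp (X Y Z : topologicalType) (A : set X) (B : set Y)
  (f : X -> Y) (g : Y -> Z) :
  cts_on A f -> (forall x, A x -> B (f x)) -> cts_on B g -> cts_on A (g \o f).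
Proof.
move=> /cts_onP cf fAB cg x Ax U /(cg _ (fAB _ Ax)) gU.
by apply: filterS (cf _ _ Ax gU) => y Uy Ay; apply: Uy => //; exact: fAB.
Qed.

Lemma cts_on_pair (X Y Z : topologicalType) (A : set X) (f : X -> Y) (g : X -> Z) :
  cts_on A f -> cts_on A g -> cts_on A (fun x => (f x, g x)).
Proof. by move=> cf cg x Ax; apply: cvg_pair; [exact: cf|exact: cg]. Qed.

Lemma cts_onU (X Y : topologicalType) (C D A : set X) (f : X -> Y) :
  closed C -> closed D -> A `<=` C `|` D ->
  cts_on (A `&` C) f -> cts_on (A `&` D) f -> cts_on A f.
Proof.
move=> clC clD ACD fC fD.
apply: (@cts_on_cover _ _ bool (fun b => if b then C else D)).
- by case.
- by move=> x /ACD[Cx|Dx]; [exists true|exists false].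
- by case.
Qed.

Lemma ptws_cvg (R : topologicalType) (I : eqType) (S : Type) (F : set_system S)
    (f : S -> {ptws I -> R}) (g : {ptws I -> R}) : Filter F ->
  (forall i, (fun s => f s i) @ F --> g i) -> f @ F --> g.
Proof.
move=> FF fg; apply/cvg_sup => i U [V] [[W] oW <-] Wg VU.
apply: (filterS VU); apply: (fg i W).
exact: open_nbhs_nbhs.
Qed.

Lemma ptws_continuous (R X : topologicalType) (I : eqType) (f : X -> {ptws I -> R}) :
  (forall i, continuous (fun x => f x i)) -> continuous f.
Proof. by move=> cf x; apply: ptws_cvg => i; exact: cf. Qed.

Lemma cts_on_comp2 (X Y Z W : topologicalType) (A : set X) (B : set (Y * Z))
    (f : X -> Y) (g : X -> Z) (F : Y * Z -> W) :
  cts_on B F -> cts_on A f -> cts_on A g -> (forall x, A x -> B (f x, g x)) ->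
  cts_on A (fun x => F (f x, g x)).
Proof.
by move=> cF cf cg AB; exact: (cts_on_comp (cts_on_pair cf cg) AB cF).
Qed.

Lemma cts_onC (X Y : topologicalType) (A : set X) (c : Y) : cts_on A (fun=> c).
Proof. by move=> x _; exact: cvg_cst. Qed.

Lemma cts_on_id (X : topologicalType) (A : set X) : cts_on A id.
Proof. by move=> x _; exact: cvg_within. Qed.

Lemma cts_on_fst (X Y : topologicalType) (A : set (X * Y)) : cts_on A fst.
Proof. by apply: continuous_cts_on => x; exact: cvg_fst. Qed.

Lemma cts_on_snd (X Y : topologicalType) (A : set (X * Y)) : cts_on A snd.
Proof. by apply: continuous_cts_on => x; exact: cvg_snd. Qed.

Section RealContinuity.
Variables (R : realType) (X : topologicalType).
Implicit Types f g : X -> R.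

Lemma ctsD f g : continuous f -> continuous g -> continuous (fun x => f x + g x).
Proof. by move=> cf cg x; apply: cvgD; [exact: cf|exact: cg]. Qed.

Lemma ctsN f : continuous f -> continuous (fun x => - f x).
Proof. by move=> cf x; apply: cvgN; exact: cf. Qed.

Lemma ctsB f g : continuous f -> continuous g -> continuous (fun x => f x - g x).
Proof. by move=> cf cg; apply: ctsD => //; exact: ctsN. Qed.

Lemma ctsM f g : continuous f -> continuous g -> continuous (fun x => f x * g x).
Proof. by move=> cf cg x; apply: cvgM; [exact: cf|exact: cg]. Qed.

Lemma ctsV f : (forall x, f x != 0) -> continuous f -> continuous (fun x => (f x)^-1).
Proof. by move=> f0 cf x; apply: cvgV => //; exact: cf. Qed.

Lemma cts_norm f : continuous f -> continuous (fun x => `|f x|).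
Proof. by move=> cf x; apply: cvg_norm; exact: cf. Qed.

Lemma cts_max f g : continuous f -> continuous g ->
  continuous (fun x => Num.max (f x) (g x)).
Proof. by move=> cf cg x; apply: (@continuous_max R X f g); [exact: cf|exact: cg]. Qed.

Lemma cts_min f g : continuous f -> continuous g ->
  continuous (fun x => Num.min (f x) (g x)).
Proof. by move=> cf cg x; apply: (@continuous_min R X f g); [exact: cf|exact: cg]. Qed.

Lemma ctsC (c : R) : continuous (fun _ : X => c).
Proof. by move=> x; exact: cvg_cst. Qed.

End RealContinuity.

Section RealContinuityBig.
Variables (R : realType) (X : topologicalType) (J : Type) (r : seq J) (P : pred J).
Variable F : J -> X -> R.
Hypothesis cF : forall j, P j -> continuous (F j).

Lemma cts_sum : continuous (fun x => \sum_(j <- r | P j) F j x).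
Proof.
apply: (@continuous_big R J +%R) => //.
by apply: ctsD => x; [exact: cvg_fst|exact: cvg_snd].
Qed.

Lemma cts_prod : continuous (fun x => \prod_(j <- r | P j) F j x).
Proof.
apply: (@continuous_big R J *%R) => //.
by apply: ctsM => x; [exact: cvg_fst|exact: cvg_snd].
Qed.

Lemma cts_bigmax : continuous (fun x => \big[Num.max/0]_(j <- r | P j) F j x).
Proof.
apply: (@continuous_big R J Num.max) => //.
by apply: cts_max => x; [exact: cvg_fst|exact: cvg_snd].
Qed.

End RealContinuityBig.

Lemma cts_comp (X Y Z : topologicalType) (f : X -> Y) (g : Y -> Z) :
  continuous f -> continuous g -> continuous (fun x => g (f x)).
Proof. by move=> cf cg x; apply: continuous_comp; [exact: cf|exact: cg]. Qed.

Lemma cts_fst (X Y : topologicalType) : continuous (@fst X Y).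
Proof. by move=> x; exact: cvg_fst. Qed.

Lemma cts_snd (X Y : topologicalType) : continuous (@snd X Y).
Proof. by move=> x; exact: cvg_snd. Qed.

Lemma cts_pair (X Y Z : topologicalType) (f : X -> Y) (g : X -> Z) :
  continuous f -> continuous g -> continuous (fun x => (f x, g x)).
Proof. by move=> cf cg x; apply: cvg_pair; [exact: cf|exact: cg]. Qed.

Lemma cts_coord (R : topologicalType) (I : eqType) (i : I) :
  continuous (fun y : {ptws I -> R} => y i).
Proof. exact: (@proj_continuous I (fun=> R) i). Qed.

Lemma cts_coord_comp (R X : topologicalType) (I : eqType) (i : I)
  (f : X -> {ptws I -> R}) : continuous f -> continuous (fun x => f x i).
Proof. by move=> cf; exact: (cts_comp cf (@cts_coord R I i)). Qed.

Lemma cts_closed (X Y : topologicalType) (f : X -> Y) (D : set Y) :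
  continuous f -> closed D -> closed [set x | D (f x)].
Proof. by move=> cf; apply: (@preimage_closed X Y f D); apply: in1W. Qed.

(** Truncation to the unit interval. Applied to the time variable, it makes homotopies continuous
    for all real times, so that no condition on time has to be carried along. *)
Definition clamp (R : realType) (x : R) : R := Num.min 1 (Num.max 0 x).

Section Clamp.
Variable R : realType.
Implicit Types x : R.

Lemma clamp_ge0 x : 0 <= clamp x.
Proof. by rewrite /clamp le_min ler01 le_max lexx. Qed.

Lemma clamp_le1 x : clamp x <= 1.
Proof. by rewrite /clamp ge_min lexx. Qed.

Lemma clamp_id x : 0 <= x <= 1 -> clamp x = x.
Proof. by move=> /andP[x0 x1]; rewrite /clamp (max_idPr x0) (min_idPr x1). Qed.

Lemma clamp_le0 x : x <= 0 -> clamp x = 0.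
Proof. by move=> x0; rewrite /clamp (max_idPl x0) (min_idPr ler01). Qed.

Lemma clamp_ge1 x : 1 <= x -> clamp x = 1.
Proof.
move=> x1; rewrite /clamp (max_idPr _) ?(min_idPl x1)//.
exact: le_trans x1.
Qed.

Lemma cts_clamp (X : topologicalType) (f : X -> R) :
  continuous f -> continuous (fun z => clamp (f z)).
Proof.
move=> cf; apply: (@cts_min R X (fun=> 1) (fun z => Num.max 0 (f z))).
  exact: ctsC.
by apply: cts_max; [exact: ctsC|exact: cf].
Qed.

End Clamp.

(** * Subcomplexes of a cube *)

Section Cube.
Variables (R : realType) (I : finType).
Local Notation T := {ptws I -> R}.
Local Notation word := {ffun I -> option bool}.
Implicit Types (y : T) (w : word) (P Q : pred word).

Definition cube : set T := [set y | forall i, 0 <= y i <= 1].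

Lemma compact_cube : compact cube.
Proof.
rewrite (_ : cube = [set y : T | forall i, `[0, 1]%classic (y i)]).
  apply: (@tychonoff I (fun=> R) (fun=> `[0, 1]%classic)) => i.
  exact: segment_compact.
by apply/seteqP; split=> y yc i; move: (yc i); rewrite /= in_itv.
Qed.

Lemma hausdorff_ptws : hausdorff_space T.
Proof.
by apply: (@hausdorff_product I (fun=> R)) => i; exact: Rhausdorff.
Qed.

Lemma closed_cube : closed cube.
Proof. by apply: compact_closed; [exact: hausdorff_ptws|exact: compact_cube]. Qed.

(* The face of the cube that carries a point is recorded by a word: a
   coordinate 0, 1 or strictly in between reads [Some false], [Some true] or
   [None]. *)
Definition letter (x : R) : option bool :=
  if x == 0 then Some false else if x == 1 then Some true else None.

Definition car y : word := [ffun i => letter (y i)].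

(** The open face of [w'] lies in the closed face of [w]. A predicate closed under this relation is
    thus the set of faces of a subcomplex. *)
Definition refines w w' := [forall i, (w i != None) ==> (w' i == w i)].

Definition face_closed P := forall w w', refines w w' -> P w -> P w'.

Definition cpx P : set T := [set y | cube y /\ P (car y)].

Lemma refinesP w w' :
  reflect (forall i b, w i = Some b -> w' i = Some b) (refines w w').
Proof.
apply: (iffP forallP) => [h i b wi|h i].
  by move: (h i); rewrite wi /= => /eqP.
by apply/implyP; case E: (w i) => [b|//] _; rewrite (h _ _ E).
Qed.

Lemma refines_refl w : refines w w.
Proof. by apply/refinesP. Qed.

Lemma letterP (x : R) (b : bool) : letter x = Some b <-> x = b%:R.
Proof.
rewrite /letter; split; last first.
  by move=> ->; case: b; rewrite /= ?eqxx ?oner_eq0.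
have [->|x0] := eqVneq x 0; first by case=> <-.
by have [->|x1] := eqVneq x 1; first by case=> <-.
Qed.

Lemma carP y i b : car y i = Some b <-> y i = b%:R.
Proof. by rewrite ffunE; exact: letterP. Qed.

(** For a point of the cube, this is the l1 distance to the closed face of [w]. *)
Definition face_dist w y : R := \sum_(i | w i != None) `|y i - (w i == Some true)%:R|.

Lemma cts_face_dist w : continuous (face_dist w).
Proof.
apply: cts_sum => i _; apply: cts_norm; apply: ctsB; last exact: ctsC.
exact: cts_coord.
Qed.

Lemma face_dist_eq0 w y : (face_dist w y == 0) = refines w (car y).
Proof.
rewrite /face_dist psumr_eq0//; apply/allP/refinesP => [h i b wi|h i _].
  have := h i (mem_index_enum _); rewrite wi /= normr_eq0 subr_eq0 => /eqP yi.
  apply/carP; rewrite yi.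
  by case: b wi yi.
apply/implyP; case E: (w i) => [b|//] _; move: (h _ _ E) => /carP ->.
by rewrite normr_eq0 subr_eq0; case: (b).
Qed.

(** Within the cube, the subcomplex is the zero set of the product of the distances to its finitely
    many faces. *)
Lemma closed_cpx P : face_closed P -> closed (cpx P).
Proof.
move=> cP.
rewrite (_ : cpx P = cube `&` [set y | \prod_(w | P w) face_dist w y = 0]).
  apply: closedI; first exact: closed_cube.
  apply: (@cts_closed _ R (fun y => \prod_(w | P w) face_dist w y) [set x | x = 0]).
    by apply: cts_prod => w _; exact: cts_face_dist.
  exact: closed_eq.
apply/seteqP; split=> y [yc h]; split => //=.
  by rewrite (bigD1 (car y)) //= (eqP (_ : face_dist _ _ == 0)) ?mul0r // face_dist_eq0 refines_refl.
have /eqP/prodf_eq0[w Pw] := h.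
by rewrite face_dist_eq0 => /cP; exact.
Qed.

Lemma compact_cpx P : face_closed P -> compact (cpx P).
Proof.
move=> cP; apply: subclosed_compact compact_cube _; first exact: closed_cpx.
by move=> y [].
Qed.

(* Expands from the centre of the cube and truncates: every closed face is
   preserved, and at time 1 a neighbourhood of a face is mapped into it. *)
Definition push (z : T * R) : T :=
  fun i => clamp ((1 + z.2) * (z.1 i - 2^-1) + 2^-1).

Lemma cts_push : continuous push.
Proof.
apply: ptws_continuous => i; apply: cts_clamp.
apply: ctsD; last exact: ctsC.
apply: ctsM; first by apply: ctsD; [exact: ctsC|exact: cts_snd].
by apply: ctsB; [apply: cts_coord_comp; exact: cts_fst|exact: ctsC].
Qed.

Lemma push_cube z : cube (push z).
Proof. by move=> i; rewrite clamp_ge0 clamp_le1. Qed.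

Lemma push0 y : cube y -> push (y, 0) = y.
Proof.
move=> yc; apply: funext => i; rewrite /push /= -[RHS](clamp_id (yc i)).
by congr clamp; ring.
Qed.

Lemma push_refines y t : 0 <= t -> refines (car y) (car (push (y, t))).
Proof.
move=> t0; apply/refinesP => i b /carP yi; apply/carP; rewrite /push /= yi.
case: b yi => /= yi; first by rewrite clamp_ge1 //; lra.
by rewrite clamp_le0 //; lra.
Qed.

(** At time 1 a coordinate x becomes the truncation of 2x - 1/2, which is 0 for x up to 1/4 and 1
    from 3/4 on; hence the bound 1/4. *)
Lemma push_near w y : face_dist w y < 4^-1 -> refines w (car (push (y, 1))).
Proof.
move=> wy; apply/refinesP => i b wi; apply/carP; rewrite /push /=.
have : `|y i - b%:R| < 4^-1.
  apply: le_lt_trans wy; rewrite /face_dist (bigD1 i) ?wi//=.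
  by case: b wi => wi; rewrite lerDl; apply: sumr_ge0.
rewrite ltr_norml => /andP[h1 h2]; case: b wi h1 h2 => /= _ h1 h2.
  by rewrite clamp_ge1 //; lra.
by rewrite clamp_le0 //; lra.
Qed.

(** A cutoff function: 1 on the subcomplex, and nonzero only at distance less than 1/4 from one of
    its faces, where [push] at time 1 lands in the subcomplex. *)
Definition bump P y : R :=
  clamp (\sum_(w | P w) Num.max 0 (1 - 4 * face_dist w y)).

Lemma cts_bump P : continuous (bump P).
Proof.
apply: cts_clamp; apply: cts_sum => w _; apply: cts_max; first exact: ctsC.
apply: ctsB; first exact: ctsC.
by apply: ctsM; [exact: ctsC|exact: cts_face_dist].
Qed.

Lemma bump1 P y : P (car y) -> bump P y = 1.
Proof.
move=> Py; apply: clamp_ge1; rewrite (bigD1 (car y)) //=.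
rewrite (eqP (_ : face_dist _ _ == 0)) ?face_dist_eq0 ?refines_refl//.
rewrite mulr0 subr0 (max_idPr ler01) lerDl.
by apply: sumr_ge0 => w _; rewrite le_max lexx.
Qed.

Lemma bump_push P y : face_closed P -> bump P y != 0 -> cpx P (push (y, 1)).
Proof.
move=> cP b0; split; first exact: push_cube.
suff [w Pw wy] : exists2 w, P w & face_dist w y < 4^-1.
  exact: cP (push_near wy) Pw.
apply: contrapT => h; move/eqP: b0; apply; apply: clamp_le0.
rewrite big1 // => w Pw; apply/max_idPl; rewrite leNgt; apply/negP => wy.
by apply: h; exists w => //; lra.
Qed.

(* The end point of the contraction need not stay fixed. *)
Definition contracts (A : set T) : Prop :=
  exists (G : T * R -> T) (p : T),
    [/\ A p, cts_on (A `*` setT) G, forall y t, A y -> A (G (y, t)),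
        forall y, A y -> G (y, 0) = y & forall y, A y -> G (y, 1) = p].

(* A homotopy extension property: the contraction of the subcomplex is
   extended by first pushing a neighbourhood into it and then damping. *)
Lemma contraction_extension P : face_closed P -> contracts (cpx P) ->
  exists (h : T * R -> T) (p : T),
    [/\ cpx P p, cts_on (cube `*` setT) h,
        forall Q, face_closed Q -> subpred P Q ->
          forall y t, cpx Q y -> cpx Q (h (y, t)),
        forall y, cube y -> h (y, 0) = y & forall y, cpx P y -> h (y, 1) = p].
Proof.
move=> cP [G [p [Pp cG GP G0 G1]]].
(* Up to time 1/2 only the push runs. Afterwards the contraction [G] is followed up to the time [s],
   which [bump P] damps to 0 away from the subcomplex. *)
pose s (z : T * R) := clamp (2 * z.2 - 1) * bump P z.1.
pose h (z : T * R) := if s z == 0 then push (z.1, clamp (2 * z.2))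
  else G (push (z.1, 1), s z).
have cs : continuous s.
  apply: ctsM; last by apply: cts_comp (@cts_bump P); exact: cts_fst.
  apply: cts_clamp; apply: ctsB; last exact: ctsC.
  by apply: ctsM; [exact: ctsC|exact: cts_snd].
have s_neq0 z : s z != 0 -> 2^-1 <= z.2 /\ cpx P (push (z.1, 1)).
  rewrite mulf_eq0 negb_or => /andP[t0 b0]; split; last exact: bump_push.
  rewrite leNgt; apply/negP => t2; move/eqP: t0; apply.
  by apply: clamp_le0; lra.
have cpush1 : continuous (fun z : T * R => push (z.1, 1)).
  by apply: cts_comp cts_push; apply: cts_pair; [exact: cts_fst|exact: ctsC].
exists h, p; split=> //.
- apply: (@cts_onU _ _ [set z | s z = 0]
    ([set z | 2^-1 <= z.2] `&` [set z | cpx P (push (z.1, 1))])).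
  + exact: (cts_closed cs (@closed_eq _ _)).
  + apply: closedI.
      exact: (cts_closed (@cts_snd _ _) (@closed_ge _ _)).
    by apply: (cts_closed cpush1); exact: closed_cpx.
  + move=> z _; have [sz|/s_neq0[]] := eqVneq (s z) 0; first by left.
    by right; split.
  + apply: (@eq_cts_on _ _ _ (fun z : T * R => push (z.1, clamp (2 * z.2)))).
      by move=> z [_ /= sz]; rewrite /h sz eqxx.
    apply: continuous_cts_on; apply: cts_comp cts_push.
    apply: cts_pair; first exact: cts_fst.
    by apply: cts_clamp; apply: ctsM; [exact: ctsC|exact: cts_snd].
  + apply: (@eq_cts_on _ _ _ (G \o (fun z : T * R => (push (z.1, 1), s z)))).
      (* Where both formulas apply, [s] is 0 and the push is complete, so [G] is evaluated at time 0
         and is the identity. *)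
      move=> [y t] [_ [/= t2 yP]]; rewrite /h; case: eqP => //= sz.
      by rewrite sz G0 // [clamp (2 * t)]clamp_ge1 //; lra.
    apply: cts_on_comp cG.
      apply: continuous_cts_on; exact: cts_pair.
    by move=> z [_ [_ ?]]; split.
- move=> Q cQ PQ y t [yc Qy]; rewrite /h; case: eqP => [_|/eqP /s_neq0[_ /=]].
    split; first exact: push_cube.
    by apply: cQ Qy; apply: push_refines; exact: clamp_ge0.
  by move=> yP; have [zc Pz] := GP _ (s (y, t)) yP; split => //; exact: PQ.
- move=> y yc; rewrite /h.
  have -> : s (y, 0) = 0 by rewrite /s clamp_le0 ?mul0r //=; lra.
  by rewrite eqxx /= clamp_le0 ?push0//; lra.
- move=> y [yc Py]; rewrite /h.
  have -> : s (y, 1) = 1.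
    by rewrite /s bump1 // mulr1 clamp_ge1 //=; lra.
  rewrite oner_eq0 G1 //; split; first exact: push_cube.
  by apply: cP Py; apply: push_refines.
Qed.

End Cube.

(** * Concatenation of deformations *)

Section Deformation.
Variables (R : realType) (X Y : topologicalType).

Definition deforms (A : set X) (B : set Y) (f g : X -> Y) : Prop :=
  exists H : X * R -> Y,
    [/\ cts_on (A `*` setT) H, forall x t, A x -> B (H (x, t)),
        forall x, A x -> H (x, 0) = f x & forall x, A x -> H (x, 1) = g x].

Lemma deforms_trans (A : set X) (B : set Y) (f g h : X -> Y) :
  deforms A B f g -> deforms A B g h -> deforms A B f h.
Proof.
move=> [H [cH HB H0 H1]] [K [cK KB K0 K1]].
pose L (z : X * R) :=
  if z.2 <= 2^-1 then H (z.1, clamp (2 * z.2)) else K (z.1, clamp (2 * z.2 - 1)).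
exists L; split.
- apply: (@cts_onU _ _ [set z : X * R | z.2 <= 2^-1] [set z : X * R | 2^-1 <= z.2]).
  + exact: (cts_closed (@cts_snd _ _) (@closed_le _ _)).
  + exact: (cts_closed (@cts_snd _ _) (@closed_ge _ _)).
  + by move=> z _; case: (leP z.2 2^-1) => [|/ltW]; [left|right].
  + apply: (@eq_cts_on _ _ _ (H \o (fun z : X * R => (z.1, clamp (2 * z.2))))).
      by move=> [x t] [_ /= t2]; rewrite /L /= t2.
    apply: cts_on_comp cH => [|z [[Az _] _]]; last by split.
    apply: continuous_cts_on; apply: cts_pair; first exact: cts_fst.
    by apply: cts_clamp; apply: ctsM; [exact: ctsC|exact: cts_snd].
  + apply: (@eq_cts_on _ _ _ (K \o (fun z : X * R => (z.1, clamp (2 * z.2 - 1))))).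
      move=> [x t] [[/= Ax _] /= t2]; rewrite /L /=; case: leP => // t2'.
      rewrite [in LHS]clamp_le0 ?[in RHS]clamp_ge1 ?K0 ?H1 //; lra.
    apply: cts_on_comp cK => [|z [[Az _] _]]; last by split.
    apply: continuous_cts_on; apply: cts_pair; first exact: cts_fst.
    apply: cts_clamp; apply: ctsB; last exact: ctsC.
    by apply: ctsM; [exact: ctsC|exact: cts_snd].
- by move=> x t Ax; rewrite /L; case: ifP => _; [exact: HB|exact: KB].
- move=> x Ax; rewrite /L /= invr_ge0 ler0n clamp_le0 ?H0 //; lra.
- move=> x Ax; rewrite /L /= ifF; last by apply/negbTE; rewrite -ltNge; lra.
  by rewrite clamp_ge1 ?K1 //; lra.
Qed.

End Deformation.

(** * Contractions of unions and of star-shaped subcomplexes *)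

Section Contraction.
Variables (R : realType) (I : finType).
Local Notation T := {ptws I -> R}.
Local Notation word := {ffun I -> option bool}.
Implicit Types (y : T) (w : word) (P Q : pred word).

Lemma contractsP (A : set T) :
  contracts A <-> exists2 p, A p & deforms R A A id (fun=> p).
Proof.
split=> [[G [p [Ap cG GA G0 G1]]]|[p Ap [G [cG GA G0 G1]]]].
  by exists p => //; exists G.
by exists G, p.
Qed.

Lemma eq_contracts P Q : P =1 Q -> contracts (cpx (R := R) P) -> contracts (cpx (R := R) Q).
Proof. by move=> PQ; rewrite (_ : P = Q) //; exact: funext. Qed.

Lemma face_closedU P Q : face_closed P -> face_closed Q -> face_closed (predU P Q).
Proof. by move=> cP cQ w w' ww' /orP[/(cP _ _ ww')|/(cQ _ _ ww')] h; apply/orP; [left|right]. Qed.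

Lemma face_closedI P Q : face_closed P -> face_closed Q -> face_closed (predI P Q).
Proof. by move=> cP cQ w w' ww' /andP[/(cP _ _ ww') ? /(cQ _ _ ww') ?]; apply/andP. Qed.

(* The base points of the three contractions need not agree: collapse the
   intersection to a point [p], then [P] to a point, and follow the image of the
   path of [p] under the contraction of [Q]. *)
Lemma contracts_glue P Q : face_closed P -> face_closed Q ->
  contracts (cpx (R := R) P) -> contracts (cpx (R := R) Q) ->
  contracts (cpx (R := R) (predI P Q)) -> contracts (cpx (R := R) (predU P Q)).
Proof.
move=> cP cQ kP [G [r [Qr cG GQ G0 G1]]] kPQ.
have cU := face_closedU cP cQ; have cI := face_closedI cP cQ.
have [h [p [PQp ch hS h0 h1]]] := contraction_extension cI kPQ.
have [l [q [Pq cl lS l0 l1]]] := contraction_extension cP kP.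
have PU : subpred P (predU P Q) by move=> w Pw; apply/orP; left.
have QU : subpred Q (predU P Q) by move=> w Qw; apply/orP; right.
have IP : subpred (predI P Q) P by move=> w /andP[].
have IQ : subpred (predI P Q) Q by move=> w /andP[].
have IU : subpred (predI P Q) (predU P Q) by move=> w /IP/PU.
have sub P1 P2 : subpred P1 P2 -> cpx (R := R) P1 `<=` cpx P2.
  by move=> P12 y [yc /P12].
have hU := hS _ cU IU; have hP := hS _ cP IP; have hQ := hS _ cQ IQ.
have lU := lS _ cU PU.
pose A := cpx (R := R) (predU P Q).
have hl1 B : B `<=` cube (R:=R) (I:=I) -> cts_on B (fun y => l (y, 1)).
  move=> Bc; apply: (cts_on_comp2 (f := id) (g := fun=> (1 : R)) cl).
  - exact: cts_on_id.
  - exact: cts_onC.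
  - by move=> y /Bc.
have Ac : A `<=` cube (R:=R) (I:=I) by move=> y [].
have AcT : A `*` setT `<=` cube (R:=R) (I:=I) `*` [set: R] by move=> y [/Ac].
apply/contractsP; exists (l (r, 1)); first by apply: lU; exact: sub Qr.
(* First stage: [h] collapses the intersection to [p]. *)
apply: (@deforms_trans _ _ _ _ _ _ (fun y => h (y, 1))).
  exists h; split => //; [exact: cts_onS ch|by move=> y [/h0]].
(* Second stage: [l] collapses the image of [P] to [q], while the whole union is carried along. *)
apply: (@deforms_trans _ _ _ _ _ _ (fun y => l (h (y, 1), 1))).
  exists (fun z => l (h (z.1, 1), z.2)); split.
  - apply: (cts_on_comp2 (f := fun z : T * R => h (z.1, 1)) cl).
    + apply: (cts_on_comp2 (f := fst) (g := fun=> (1 : R)) ch) => [||z [/Ac]//].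
        exact: cts_on_fst.
      exact: cts_onC.
    + exact: cts_on_snd.
    + by move=> z [Az _]; split => //; apply: Ac; exact: hU.
  - by move=> y t Ay; apply: lU; exact: hU.
  - by move=> y Ay; rewrite l0 //; apply: Ac; exact: hU.
  - by [].
(* Third stage: [Q] contracts by [G] beneath the end map of [l], while all of [P], now at [q], the
   image of [p], follows the image of the path of [p]. On the intersection both formulas agree
   because [h] has sent it to [p]. *)
exists (fun z => if Q (car z.1) then l (G (h (z.1, 1), z.2), 1) else l (G (p, z.2), 1)).
have Qp := sub _ _ IQ _ PQp.
split.
- apply: (@cts_onU _ _ [set z : T * R | cpx Q z.1] [set z : T * R | cpx P z.1]).
  + by apply: (cts_closed (@cts_fst _ _)); exact: closed_cpx.
  + by apply: (cts_closed (@cts_fst _ _)); exact: closed_cpx.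
  + by move=> z [[zc /orP[]] h' _]; [right|left].
  + apply: (@eq_cts_on _ _ _ (fun z : T * R => l (G (h (z.1, 1), z.2), 1))).
      by move=> [y t] [_ [_ /= Qy]]; rewrite ifT.
    apply: (@cts_on_comp _ _ _ _ _ (fun z : T * R => G (h (z.1, 1), z.2))
      (fun y => l (y, 1)) _ _ (hl1 (cube (I := I)) (fun y h => h))).
      apply: (cts_on_comp2 (f := fun z : T * R => h (z.1, 1)) cG).
      - apply: (cts_on_comp2 (f := fst) (g := fun=> (1 : R)) ch) => [||z [[/Ac]]//].
          exact: cts_on_fst.
        exact: cts_onC.
      - exact: cts_on_snd.
      - by move=> z [_ /= Qz]; split => //; exact: hQ.
    by move=> z [_ /= Qz]; have [] := GQ (h (z.1, 1)) z.2 (hQ _ _ Qz).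
  + apply: (@eq_cts_on _ _ _ (fun z : T * R => l (G (p, z.2), 1))).
      move=> [y t] [_ [/= yc Py]]; case: ifP => // Qy.
      by rewrite h1 //; split => //; apply/andP.
    apply: (@cts_on_comp _ _ _ _ _ (fun z : T * R => G (p, z.2))
      (fun y => l (y, 1)) _ _ (hl1 (cube (I := I)) (fun y h => h))).
      apply: (cts_on_comp2 (f := fun=> p) cG) => //.
        exact: cts_onC.
      exact: cts_on_snd.
    by move=> z _; have [] := GQ p z.2 Qp.
- move=> y t [yc _]; case: ifP => Qy; apply: lU; apply: sub (QU) _ _.
    by apply: GQ; apply: hQ; split.
  exact: GQ.
- move=> y [yc UQ] /=; case: ifP => Qy; first by rewrite G0 //; apply: hQ; split.
  have Py : cpx P y by split => //; case/orP: UQ => //; rewrite [_ (car y)]Qy.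
  by rewrite G0 // !l1 //; [exact: hP|exact: sub PQp].
- move=> y [yc UQ] /=; case: ifP => Qy; rewrite G1 //.
  by apply: hQ; split.
Qed.

(** For a vertex [c], this is the face that carries the interior of the segment from a point of the
    open face [w] to [c]: a coordinate stays at 0 or 1 only where the two ends agree. *)
Definition wmeet w c : word := [ffun i => if w i == c i then c i else None].

(** The subcomplex is star-shaped about the vertex [c], and the straight-line contraction applies;
    its two end times are treated apart, as [wmeet] describes only the interior of the segments. *)
Lemma contracts_star P (c : word) : (forall i, c i != None) -> P c ->
  (forall w, P w -> P (wmeet w c)) -> contracts (cpx (R := R) P).
Proof.
move=> cN Pc Pm.
pose p : T := fun i => (c i == Some true)%:R.
have pE i b : c i = Some b -> p i = b%:R by rewrite /p => ->; case: b.
have carp : car p = c.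
  apply/ffunP => i; case E: (c i) (cN i) => [b|//] _; apply/carP; exact: pE.
have pc : cube p by move=> i; rewrite /p; case: (_ == _); rewrite /= lexx ler01.
exists (fun z i => (1 - clamp z.2) * z.1 i + clamp z.2 * p i), p; split.
- by split; rewrite ?carp.
- apply: continuous_cts_on; apply: ptws_continuous => i; apply: ctsD; apply: ctsM.
  + apply: ctsB; first exact: ctsC.
    by apply: cts_clamp; exact: cts_snd.
  + by apply: cts_coord_comp; exact: cts_fst.
  + by apply: cts_clamp; exact: cts_snd.
  + exact: ctsC.
- move=> y t [yc Py].
  have /andP[s0 s1] : 0 <= clamp t <= 1 by rewrite clamp_ge0 clamp_le1.
  move: (clamp t) s0 s1 => s s0 s1; split.
    move=> i /=; have /andP[y0 y1] := yc i; have /andP[p0 p1] := pc i.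
    by apply/andP; split; nra.
  have [->|sn0] := eqVneq s 0.
    by rewrite (_ : (fun i => _) = y) //; apply: funext => i /=; ring.
  have [->|sn1] := eqVneq s 1.
    rewrite (_ : (fun i => _) = p) ?carp //; apply: funext => i /=; ring.
  rewrite (_ : car _ = wmeet (car y) c); first exact: Pm.
  have {}s0 : 0 < s by rewrite lt_neqAle eq_sym sn0.
  have {}s1 : s < 1 by rewrite lt_neqAle sn1.
  apply/ffunP => i; rewrite !ffunE; have /andP[y0 y1] := yc i.
  case E: (c i) (cN i) => [b|//] _; rewrite (pE _ _ E).
  case: eqP => [/letterP yb|yb].
    by apply/letterP => /=; rewrite yb; ring.
  have {}yb : y i != b%:R by apply/eqP => /letterP.
  rewrite /letter; case: b yb {E} => /= yb.
    have {}y1 : y i < 1 by rewrite lt_neqAle yb.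
    by rewrite !ifF //; apply/negbTE; [rewrite neq_lt|rewrite neq_lt]; apply/orP; [left|right]; nra.
  have {}y0 : 0 < y i by rewrite lt_neqAle eq_sym yb.
  by rewrite !ifF //; apply/negbTE; [rewrite neq_lt|rewrite neq_lt]; apply/orP; [left|right]; nra.
- by move=> y _; apply: funext => i /=; rewrite clamp_le0 //; ring.
- by move=> y _; apply: funext => i /=; rewrite clamp_ge1 //; ring.
Qed.

End Contraction.

(** * The contractible subcomplex and the critical cells *)

Section CriticalWords.
Implicit Types (l : seq (option bool)) (a b : nat).

Definition zeros l := count_mem (Some false) l.
Definition ones l := count_mem (Some true) l.

Definition in_slab a b l := (a <= zeros l)%N && (b <= ones l)%N.

Definition bottom_word a b := nseq b (Some true) ++ nseq a (Some false).

(* The words of the top-dimensional cells to be left out. When [size l = a + b],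
   the complex consists of points, and all but one of them are left out. *)
Fixpoint critical a b l : bool :=
  if l is x :: l' then
    if (a == 0) || (b == 0) then false
    else if (size l <= a + b)%N then in_slab a b l && (l != bottom_word a b)
    else match x with
      | None => critical a b l'
      | Some false => critical a.-1 b l'
      | Some true => critical a b.-1 l'
      end
  else false.

Definition collapsible a b l := in_slab a b l && ~~ critical a b l.

Lemma zeros_ones_size l : (zeros l + ones l <= size l)%N.
Proof.
rewrite /zeros /ones; elim: l => [//|x l] /=.
by move: (count _ l) (count _ l) => z o; case: x => [[]|] /=; lia.
Qed.

(** Each recursive call lowers the bounds by what the first letter contributes, and in the discrete
    case the size leaves no room for further digits. Critical cells are therefore of top
    dimension. *)
Lemma critical_count a b l : critical a b l -> zeros l = a /\ ones l = b.
Proof.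
elim: l a b => [//|x l IH] a b /=; case: ifP => // /norP[a0 b0].
case: ifP => [sz /andP[/andP[/= az bo] _]|_].
  move: (zeros l) (ones l) (zeros_ones_size l) az bo sz => z o.
  by case: x => [[]|] /=; lia.
by case: x => [[]|] /IH[] /=; move: (zeros l) (ones l) => z o; lia.
Qed.

Definition letter_refines (x y : option bool) := (x == None) || (x == y).

Lemma all2_refines_count l l' : all2 letter_refines l l' ->
  [/\ (zeros l <= zeros l')%N, (ones l <= ones l')%N &
      zeros l = zeros l' -> ones l = ones l' -> l = l'].
Proof.
rewrite /zeros /ones.
elim: l l' => [|x l IH] [|y l'] //= /andP[xy /IH[z o e]].
case/orP: xy => /eqP ->; last first.
  by split; rewrite ?leq_add2l // => /addnI h /addnI h'; rewrite e.
rewrite /= !add0n; split; rewrite ?(leq_trans z) ?(leq_trans o) ?leq_addl //.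
move: z o e; move: (count _ l) (count _ l) (count _ l') (count _ l').
move=> z o z' o' zz' oo' e; case: y => [[]|] /= h h'; try lia.
by rewrite e.
Qed.

(** A proper face has an additional digit, hence too many zeros or ones to be critical. Omitting
    open top-dimensional cells thus leaves a subcomplex. *)
Lemma collapsible_refines a b l l' : all2 letter_refines l l' ->
  collapsible a b l -> collapsible a b l'.
Proof.
move=> /all2_refines_count[zl ol e] /andP[/andP[az bo] nc].
rewrite /collapsible /in_slab (leq_trans az zl) (leq_trans bo ol) /=.
apply: contra nc => /[dup] /critical_count[zE oE].
by rewrite e //; lia.
Qed.

(** Above the discrete case, the first letter sorts the cells into the three smaller complexes of
    the induction. *)
Lemma collapsible_cons a b x l : (0 < a)%N -> (0 < b)%N -> (a + b <= size l)%N ->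
  collapsible a b (x :: l) = match x with
      | None => collapsible a b l
      | Some false => collapsible a.-1 b l
      | Some true => collapsible a b.-1 l
      end.
Proof.
move=> a0 b0 ab; rewrite /collapsible /= -(negbK ((_ == 0) || _)) negb_or.
rewrite -!lt0n a0 b0 /= leqNgt ltnS ab /= /in_slab /zeros /ones.
by case: x => [[]|] /=; congr (_ && _); lia.
Qed.

(** A word with at least b ones has too many to be critical for b - 1. So the complex over the
    interval embeds in the one at its end. *)
Lemma collapsible_pred1 a b l : (0 < b)%N ->
  collapsible a b l -> collapsible a b.-1 l.
Proof.
move=> b0 /andP[/andP[az bo] nc]; rewrite /collapsible /in_slab az /=.
rewrite (leq_trans (leq_pred _) bo) /=; apply/negP => /critical_count[_]; lia.
Qed.

Lemma collapsible_pred0 a b l : (0 < a)%N ->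
  collapsible a b l -> collapsible a.-1 b l.
Proof.
move=> a0 /andP[/andP[az bo] nc]; rewrite /collapsible /in_slab bo /=.
rewrite (leq_trans (leq_pred _) az) /=; apply/negP => /critical_count[]; lia.
Qed.

Lemma collapsible0 b l : collapsible 0 b l = (b <= ones l)%N.
Proof. by rewrite /collapsible /in_slab; case: l => [|x l] /=; rewrite ?andbT. Qed.

Lemma collapsible_0 a l : collapsible a 0 l = (a <= zeros l)%N.
Proof.
by rewrite /collapsible /in_slab; case: l => [|x l] /=; rewrite ?orbT ?andbT.
Qed.

Lemma collapsible_bottom a b l : (0 < a)%N -> (0 < b)%N -> size l = (a + b)%N ->
  collapsible a b l = (l == bottom_word a b).
Proof.
move=> a0 b0 sl; rewrite /collapsible.
have -> : critical a b l = in_slab a b l && (l != bottom_word a b).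
  case: l sl => [|x l] sl; first by exfalso; move: sl => /=; lia.
  rewrite /= -(negbK ((a == 0) || _)) negb_or -!lt0n a0 b0 /= ifT //.
  by rewrite -sl.
have [->|_] := eqVneq; last by rewrite andbT andbN.
rewrite andbF andbT /in_slab /zeros /ones !count_cat !count_nseq /=; lia.
Qed.

End CriticalWords.

(** * Contractibility of the complex without the critical cells *)

Section CollapsibleComplex.
Variables (R : realType) (I : finType).
Local Notation word := {ffun I -> option bool}.
Implicit Types (s : seq I) (v w c : word) (a b : nat).

(** All complexes of the induction live in one cube: digits are counted along [s], and the other
    coordinates only have to stay in the closed face that [v] prescribes. *)
Definition off_face s v w := [forall i, (i \notin s) ==> letter_refines (v i) (w i)].

Definition collapsible_complex s v a b : pred word :=
  fun w => collapsible a b [seq w i | i <- s] && off_face s v w.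

Definition update_word v i x : word := [ffun j => if j == i then x else v j].

Lemma face_closed_collapsible s v a b : face_closed (collapsible_complex s v a b).
Proof.
move=> w w' /refinesP ww' /andP[cw /forallP ow]; apply/andP; split.
  apply: collapsible_refines cw; elim: s {ow} => //= i s ->; rewrite andbT.
  rewrite /letter_refines; case E: (w i) => [b'|//].
  by rewrite (ww' _ _ E) eqxx orbT.
apply/forallP => i; apply/implyP => /(implyP (ow i)) /orP[/eqP vi|/eqP vi].
  by rewrite /letter_refines vi eqxx.
rewrite /letter_refines vi; case E: (w i) => [b'|//].
by rewrite (ww' _ _ E) eqxx orbT.
Qed.

Lemma off_face_update i s v w x : i \notin s ->
  off_face s (update_word v i x) w = letter_refines x (w i) && off_face (i :: s) v w.
Proof.
move=> si; apply/forallP/andP => [h|[xi /forallP h] j].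
  split; first by move: (h i); rewrite si ffunE eqxx.
  apply/forallP => j; apply/implyP; rewrite inE negb_or => /andP[ji js].
  by move: (h j); rewrite js ffunE (negPf ji).
apply/implyP => js; rewrite ffunE; case: eqP => [->//|/eqP ji].
by move: (h j); rewrite inE negb_or ji js.
Qed.

(** The pieces are the two ends in the direction [i] and the closed cylinder between them, whose own
    ends are absorbed because lowering a bound enlarges the complex. *)
Lemma collapsible_complex_cons i s v a b : i \notin s -> (0 < a)%N -> (0 < b)%N ->
  (a + b <= size s)%N ->
  predU (predU (collapsible_complex s (update_word v i (Some true)) a b.-1)
               (collapsible_complex s (update_word v i None) a b))
        (collapsible_complex s (update_word v i (Some false)) a.-1 b)
    =1 collapsible_complex (i :: s) v a b.
Proof.
move=> si a0 b0 ab w; rewrite /= /collapsible_complex !off_face_update // /letter_refines /=.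
rewrite collapsible_cons ?size_map //.
set l := map _ _; case: (w i) => [[]|] /=; rewrite ?andbF ?orbF ?andbT //=.
  apply/orP/idP => [[//|/andP[cl ->]]|->]; last by left.
  by rewrite collapsible_pred1.
apply/orP/idP => [[/andP[cl ->]|//]|->]; last by right.
by rewrite collapsible_pred0.
Qed.

Lemma collapsible_complex_meet s v a b c w :
  (collapsible a b [seq w i | i <- s] ->
    collapsible a b [seq wmeet w c i | i <- s]) ->
  off_face s v c -> collapsible_complex s v a b w -> collapsible_complex s v a b (wmeet w c).
Proof.
move=> cm /forallP oc /andP[/cm cw /forallP ow]; apply/andP; split => //.
apply/forallP => i; apply/implyP => si; move: (oc i) (ow i); rewrite si /=.
rewrite /letter_refines ffunE => /orP[-> //|/eqP ci] /orP[-> //|/eqP wi].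
by rewrite -ci -wi eqxx eqxx orbT.
Qed.

Lemma contracts_collapsible_star s v a b (t : I -> bool) :
  collapsible a b [seq Some (t i) | i <- s] ->
  (forall w, collapsible a b [seq w i | i <- s] ->
    collapsible a b [seq if w i == Some (t i) then Some (t i) else None | i <- s]) ->
  contracts (cpx (R := R) (collapsible_complex s v a b)).
Proof.
move=> ct cm.
(* Off [s] the centre must be a vertex of the closed face of [v]; the default [true] at its free
   coordinates is an arbitrary choice. *)
pose c : word := [ffun i => Some (if i \in s then t i else odflt true (v i))].
have oc : off_face s v c.
  apply/forallP => i; apply/implyP => si; rewrite ffunE (negPf si).
  by rewrite /letter_refines; case: (v i) => [b'|] //=; rewrite eqxx.
apply: (@contracts_star R I _ c) => [i|| w cw]; first by rewrite ffunE.
  apply/andP; split => //; rewrite (_ : map _ _ = [seq Some (t i) | i <- s]) //.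
  by apply/eq_in_map => i si; rewrite ffunE si.
apply: collapsible_complex_meet => // {cw} cw.
rewrite (_ : map _ _ = [seq if w i == Some (t i) then Some (t i) else None | i <- s]).
  exact: cm.
by apply/eq_in_map => i si; rewrite !ffunE si.
Qed.

Lemma contracts_collapsible s : uniq s -> forall v a b, (a + b <= size s)%N ->
  contracts (cpx (R := R) (collapsible_complex s v a b)).
Proof.
elim: s => [_|i s IH /andP[/= si us]] v a b ab.
  by apply: (@contracts_collapsible_star _ _ _ _ xpredT) => //; case: a b ab => [|?] [].
(* With no zeros required, the all-ones vertex is a centre: moving towards it keeps every letter
   1. *)
have [a0|a0] := posnP a.
  apply: (@contracts_collapsible_star _ _ _ _ xpredT) => [|w].
    rewrite a0 collapsible0 /ones count_map (eq_count (a2 := predT)) //.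
    by rewrite count_predT; move: ab; rewrite a0.
  rewrite a0 !collapsible0 => /leq_trans; apply; rewrite /ones !count_map.
  by apply: sub_count => j /= /eqP ->.
(* Symmetrically, with no ones required the all-zeros vertex is a centre. *)
have [b0|b0] := posnP b.
  apply: (@contracts_collapsible_star _ _ _ _ xpred0) => [|w].
    rewrite b0 collapsible_0 /zeros count_map (eq_count (a2 := predT)) //.
    by rewrite count_predT; move: ab; rewrite b0 addn0.
  rewrite b0 !collapsible_0 => /leq_trans; apply; rewrite /zeros !count_map.
  by apply: sub_count => j /= /eqP ->.
move: ab; rewrite /= leq_eqVlt => /orP[/eqP ab|ab].
  (* Discrete case: along [i :: s] only the vertex spelled by [l] remains, and it serves as the
     centre. *)
  set l := bottom_word a b.
  have sl : size l = size (i :: s) by rewrite size_cat !size_nseq /= -ab addnC.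
  pose t j := nth (Some false) l (index j (i :: s)) == Some true.
  have tE : [seq Some (t j) | j <- i :: s] = l.
    apply: (@eq_from_nth _ (Some false)); first by rewrite size_map sl.
    move=> n; rewrite size_map => ns.
    rewrite (nth_map i) // /t index_uniq //=; last by rewrite si.
    rewrite /l /bottom_word nth_cat; case: ifP => h.
      by rewrite nth_nseq; case: ifP.
    by rewrite nth_nseq; case: ifP.
  apply: (@contracts_collapsible_star _ _ _ _ t) => [|w].
    by rewrite tE collapsible_bottom ?eqxx // sl.
  rewrite !(collapsible_bottom a0 b0) ?size_map -?ab // => /eqP wl.
  apply/eqP; rewrite -/l -tE.
  apply/eq_in_map => j js; case: eqP => // wj; exfalso; apply: wj.
  move: wl; rewrite -/l -tE => /eq_in_map; exact.
apply: eq_contracts (collapsible_complex_cons v si a0 b0 _) _; first by lia.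
have cc := face_closed_collapsible.
have cU := face_closedU (cc s (update_word v i (Some true)) a b.-1)
                        (cc s (update_word v i None) a b).
apply: (contracts_glue cU (@cc _ _ _ _)).
- apply: (contracts_glue (@cc _ _ _ _) (@cc _ _ _ _)); [by apply: IH => //; lia|exact: IH|].
  (* The end at 1 meets the cylinder in a copy of the (a, b) complex. *)
  apply: (@eq_contracts R I (collapsible_complex s (update_word v i (Some true)) a b));
    last exact: IH.
  move=> w; rewrite /= /collapsible_complex !off_face_update // /letter_refines /=.
  case: eqP => _; rewrite ?andbF //=.
  apply/idP/idP => [/andP[cl ->]|/andP[_ //]].
  by rewrite collapsible_pred1 // cl.
- by apply: IH => //; lia.
(* The end at 0 is disjoint from the end at 1, so it meets their union only along the cylinder,
   again in a copy of the (a, b) complex. *)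
- apply: (@eq_contracts R I (collapsible_complex s (update_word v i (Some false)) a b));
    last exact: IH.
  move=> w; rewrite /= /collapsible_complex !off_face_update // /letter_refines /=.
  case: (w i) => [[]|]; rewrite ?andbF //=.
  apply/idP/idP => [/andP[cl ->]|/andP[]].
    by rewrite collapsible_pred0 // cl.
  by move=> /andP[-> ->].
Qed.
End CollapsibleComplex.

(** * The number of critical cells *)

Section CountCritical.

Fixpoint words n : seq (seq (option bool)) :=
  if n is n'.+1 then
    [seq None :: l | l <- words n'] ++ [seq Some false :: l | l <- words n'] ++
    [seq Some true :: l | l <- words n']
  else [:: [::]].

Lemma mem_words n l : (l \in words n) = (size l == n).
Proof.
elim: n l => [|n IH] [|x l] //=.
  by rewrite !mem_cat; apply/negP => /or3P[] /mapP[].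
rewrite eqSS -IH !mem_cat; apply/idP/idP.
  by case/or3P => /mapP[l' h [_ ->]].
move=> h; have m y : y :: l \in [seq y :: l | l <- words n] by apply: map_f.
by case: x => [[]|]; rewrite m ?orbT.
Qed.

Lemma uniq_words n : uniq (words n).
Proof.
elim: n => [//|n IH]; rewrite /= !cat_uniq !map_inj_uniq ?IH; try by move=> ? ? [].
by rewrite /= !andbT; apply/andP; split; apply/hasPn => l;
  rewrite ?mem_cat; [move=> /orP[]|]; move=> /mapP[l' _ ->]; apply/mapP => -[].
Qed.

Lemma size_words l n : l \in words n -> size l = n.
Proof. by rewrite mem_words => /eqP. Qed.

Definition ncritical n a b := count (critical a b) (words n).

Lemma ncriticalS n a b : (0 < a)%N -> (0 < b)%N -> (a + b <= n)%N ->
  ncritical n.+1 a b = (ncritical n a b + (ncritical n a.-1 b + ncritical n a b.-1))%N.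
Proof.
move=> a0 b0 ab; rewrite /ncritical /= !count_cat !count_map.
by congr (_ + (_ + _))%N; apply: eq_in_count => l /size_words sl /=;
  rewrite -(negbK (_ || _)) negb_or -!lt0n a0 b0 /= sl ltnNge ab.
Qed.

Lemma ncritical0 n b : ncritical n 0 b = 0%N.
Proof. by rewrite /ncritical (eq_count (a2 := pred0)) ?count_pred0 // => -[]. Qed.

Lemma ncritical_0 n a : ncritical n a 0 = 0%N.
Proof.
rewrite /ncritical (eq_count (a2 := pred0)) ?count_pred0 // => -[|x l] //=.
by rewrite orbT.
Qed.

Lemma ncritical11 n : ncritical n.+2 1 1 = 1%N.
Proof.
by elim: n => [|n IH]; [vm_compute|rewrite ncriticalS // IH ncritical0 ncritical_0].
Qed.

Lemma ncritical12 n : ncritical n.+3 1 2 = n.+2.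
Proof.
elim: n => [|n IH]; first by vm_compute.
by rewrite ncriticalS //= IH ncritical0 ncritical11 add0n addn1.
Qed.

Lemma ncritical21 n : ncritical n.+3 2 1 = n.+2.
Proof.
elim: n => [|n IH]; first by vm_compute.
by rewrite ncriticalS //= IH ncritical_0 ncritical11 addn0 addn1.
Qed.

(** For k = 0 five of the six vertices are left out. From k to k + 1 the recursion adds (k + 3) + (k
    + 3), the increment of the quadratic polynomial. *)
Lemma ncritical22 k : ncritical (k + 4) 2 2 = (k ^ 2 + 5 * k + 5)%N.
Proof.
elim: k => [|k IH]; first by vm_compute.
rewrite addSn ncriticalS ?IH //; last by lia.
by rewrite addn4 /= ncritical12 ncritical21; lia.
Qed.

End CountCritical.

(** * Homotopy equivalences *)

Lemma inj_hausdorff (X Y : topologicalType) (f : X -> Y) :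
  continuous f -> injective f -> hausdorff_space Y -> hausdorff_space X.
Proof.
move=> cf fI hY x y xy; apply: fI; apply: hY => U V /cf Ux /cf Vy.
by have [z [Uz Vz]] := xy _ _ Ux Vy; exists (f z).
Qed.

Lemma hausdorff_prod (X Y : topologicalType) :
  hausdorff_space X -> hausdorff_space Y -> hausdorff_space (X * Y)%type.
Proof.
move=> hX hY [x1 y1] [x2 y2] xy; congr pair.
  apply: hX => U V Ux Vx.
  have [||z [Uz Vz]] := xy (fst @^-1` U) (fst @^-1` V); last by exists z.1.
  - exact: (@cts_fst X Y (x1, y1)).
  - exact: (@cts_fst X Y (x2, y2)).
apply: hY => U V Uy Vy.
have [||z [Uz Vz]] := xy (snd @^-1` U) (snd @^-1` V); last by exists z.2.
- exact: (@cts_snd X Y (x1, y1)).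
- exact: (@cts_snd X Y (x2, y2)).
Qed.

Section Homotopy.
Variable R : realType.

(** Truncating the time extends a homotopy from the unit interval to the whole line. *)
Lemma homotopicP (X Y : topologicalType) (f g : X -> Y) :
  homotopic R f g <-> deforms R setT setT f g.
Proof.
split=> [[H [cH H0 H1]]|[H [cH _ H0 H1]]].
  exists (fun z => H (z.1, clamp z.2)); split => //.
  - have {}cH : cts_on ([set: X] `*` [set t : R | 0 <= t <= 1]) H.
      by have /subspace_continuousP := cH.
    apply: (cts_on_comp2 cH).
    + exact: cts_on_fst.
    + by apply: continuous_cts_on; apply: cts_clamp; exact: cts_snd.
    + by move=> z _; split => //=; rewrite clamp_ge0 clamp_le1.
  - by move=> x _; rewrite /= clamp_le0.
  - by move=> x _; rewrite /= clamp_ge1.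
exists H; split; [|by move=> x; exact: H0|by move=> x; exact: H1].
by apply/subspace_continuousP; exact: cts_onS cH.
Qed.

Lemma homotopic_trans (X Y : topologicalType) (f g h : X -> Y) :
  homotopic R f g -> homotopic R g h -> homotopic R f h.
Proof. by rewrite !homotopicP; exact: deforms_trans. Qed.

Lemma homotopic_comp (X Y Z W : topologicalType) (u : Z -> X) (f g : X -> Y)
    (v : Y -> W) : continuous u -> continuous v ->
  homotopic R f g -> homotopic R (v \o f \o u) (v \o g \o u).
Proof.
move=> cu cv; rewrite !homotopicP => -[H [cH _ H0 H1]].
exists (fun z => v (H (u z.1, z.2))); split => //.
- apply: (@cts_on_comp _ _ _ _ setT (fun z : Z * R => H (u z.1, z.2)) v) => //.
    apply: (cts_on_comp2 (f := fun z : Z * R => u z.1) cH) => //.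
      by apply: continuous_cts_on; apply: (cts_comp _ cu); exact: cts_fst.
    exact: cts_on_snd.
  exact: continuous_cts_on.
- by move=> x _; rewrite H0.
- by move=> x _; rewrite H1.
Qed.

Lemma homotopy_equivalent_trans (X Y Z : topologicalType) :
  homotopy_equivalent R X Y -> homotopy_equivalent R Y Z ->
  homotopy_equivalent R X Z.
Proof.
move=> [f [g [cf cg gf fg]]] [u [v [cu cv vu uv]]].
exists (u \o f), (g \o v); split.
- exact: (cts_comp cf cu).
- exact: (cts_comp cv cg).
- exact: homotopic_trans (homotopic_comp cf cg vu) gf.
- exact: homotopic_trans (homotopic_comp cv cu fg) uv.
Qed.

(** The preimage under [G] of a closed set meets f(C) in the image of a closed part of [C]; this
    image is compact, hence closed in the Hausdorff space [W]. *)
Lemma compact_descent (X W Z : topologicalType) (C : set X) (f : X -> W) (G : W -> Z) :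
  compact C -> hausdorff_space W -> continuous f -> continuous (G \o f) ->
  {within f @` C, continuous G}.
Proof.
move=> kC hW cf cGf; apply/continuous_closedP => V clV; apply/closed_subspaceP.
exists (f @` (C `&` [set x | V (G (f x))])).
  apply: compact_closed => //; apply: continuous_compact.
    exact: continuous_subspaceT.
  by apply: compact_closedI => //; exact: (cts_closed cGf).
apply/seteqP; split=> w.
  by move=> [[x [Cx Vx] <-] _]; split => //; exists x.
by move=> [Vw [x Cx xw]]; split; exists x => //; split => //=; rewrite xw.
Qed.

(* Collapsing a subspace that contracts inside the whole space is a homotopy
   equivalence; compactness makes [f] (and [f] times the unit interval) a
   quotient map. *)
Lemma collapse_equivalence (X W : topologicalType) (A : set X) (w0 : W)
    (f : X -> W) (h : X * R -> X) (p : X) :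
  compact [set: X] -> hausdorff_space W -> continuous f ->
  (forall w, exists x, f x = w) ->
  (forall x, A x -> f x = w0) ->
  (forall x y, f x = f y -> x = y \/ A x /\ A y) ->
  continuous h -> (forall x t, A x -> A (h (x, t))) ->
  (forall x, h (x, 0) = x) -> (forall x, A x -> h (x, 1) = p) ->
  homotopy_equivalent R X W.
Proof.
move=> kX hW cf fS fA fI ch hA h0 h1.
have [r rK] := choice fS.
(* The section [r] need not be continuous. Its choice does not affect [g] and [K]: two points of one
   fibre are equal or both in [A], which [h] keeps in [A] and sends to [p] at time 1. *)
pose g w := h (r w, 1).
pose K (z : W * R) := f (h (r z.1, z.2)).
have gf x : g (f x) = h (x, 1).
  by rewrite /g; have [->//|[Ar Ax]] := fI _ _ (rK (f x)); rewrite !h1.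
have Kf x t : K (f x, t) = f (h (x, t)).
  rewrite /K /=; have [->//|[Ar Ax]] := fI _ _ (rK (f x)).
  by rewrite (fA _ (hA _ t Ar)) (fA _ (hA _ t Ax)).
have ch1 : continuous (fun x => h (x, 1)).
  by apply: (cts_comp _ ch); apply: cts_pair => x; [exact: cvg_id|exact: cvg_cst].
have cg : continuous g.
  have : {within f @` setT, continuous g}.
    apply: compact_descent => //.
    by rewrite (_ : g \o f = fun x => h (x, 1)) //; apply: funext => x; exact: gf.
  rewrite (_ : f @` setT = setT); first by move=> ?; exact/continuous_subspace_setT.
  by apply/seteqP; split=> // w _; have [x xw] := fS w; exists x.
exists f, g; split=> //.
- apply/homotopicP; exists (fun z => h (z.1, 1 - z.2)); split => //.
  + apply: continuous_cts_on; apply: (cts_comp _ ch).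
    apply: cts_pair; first exact: cts_fst.
    by apply: ctsB; [exact: ctsC|exact: cts_snd].
  + by move=> x _; rewrite /= subr0 gf.
  + by move=> x _; rewrite /= subrr h0.
exists (fun z => K (z.1, 1 - z.2)); split => /=.
- pose F (z : X * R) : W * R := (f z.1, z.2).
  pose G (z : W * R) := K (z.1, 1 - z.2).
  have -> : [set: W] `*` [set t : R | 0 <= t <= 1] = F @` ([set: X] `*` `[0, 1]%classic).
    apply/seteqP; split=> [[w t] [_ /= t01]|_ [[x t] [_ /= t01] <-]].
      by have [x xw] := fS w; exists (x, t); rewrite /F /= ?xw // in_itv.
    by split => //=; move: t01; rewrite in_itv.
  apply: (@compact_descent _ _ _ _ F G).
  + by apply: compact_setX => //; exact: segment_compact.
  + by apply: hausdorff_prod => //; exact: Rhausdorff.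
  + by apply: cts_pair; [exact: (cts_comp (@cts_fst _ _) cf)|exact: cts_snd].
  + rewrite (_ : G \o F = fun z => f (h (z.1, 1 - z.2))); last first.
      by apply: funext => -[x t]; rewrite /= /G /F /= Kf.
    apply: (cts_comp _ cf); apply: (cts_comp _ ch).
    apply: cts_pair; first exact: cts_fst.
    by apply: ctsB; [exact: ctsC|exact: cts_snd].
- by move=> w; rewrite subr0.
- by move=> w; rewrite subrr /K /= h0 rK.
Qed.

End Homotopy.

Lemma mx_continuous (X R : topologicalType) m n (f : X -> 'M[R]_(m, n)) :
  (forall i j, continuous (fun x => f x i j)) -> continuous f.
Proof.
move=> cf x U [P Px PU].
have : \forall y \near x, forall i j, P i j (f y i j).
  by apply: filter_forall => i; apply: filter_forall => j; exact: cf (Px i j).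
by apply: filterS => y Py; exact: PU.
Qed.

Lemma bigmaxZ (R : realType) (J : finType) (P : pred J) (c : R) (F : J -> R) :
  0 <= c ->
  \big[Num.max/0]_(e | P e) (c * F e) = c * \big[Num.max/0]_(e | P e) F e.
Proof.
move=> c0; rewrite (big_morph (fun x => c * x) (id1 := 0) (op1 := Num.max)) //.
  by move=> x y; rewrite maxr_pMr.
by rewrite mulr0.
Qed.

(** * The sphere as the cube with its boundary collapsed *)

Section CubeToSphere.
Variables (R : realType) (k : nat).
Local Notation T := {ptws 'I_k -> R}.
Implicit Types z : T.

Definition sqnorm z : R := \sum_j z j ^+ 2.
Definition supnorm z : R := \big[Num.max/0]_j `|z j|.
Definition gap z : R := 1 - supnorm z.
Definition denom z : R := sqnorm z + gap z ^+ 2.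

(* Inverse stereographic projection, from the base point, of z / gap z. The
   denominators are cleared, so that the boundary of the cube, where the gap
   vanishes, goes to the base point. *)
Definition cube_sphere_row z : 'rV[R]_k.+1 :=
  \row_i if unlift ord0 i is Some j then 2 * gap z * z j / denom z
         else (sqnorm z - gap z ^+ 2) / denom z.

Lemma cube_sphere_row0 z :
  cube_sphere_row z ord0 ord0 = (sqnorm z - gap z ^+ 2) / denom z.
Proof. by rewrite mxE unlift_none. Qed.

Lemma cube_sphere_rowS z j :
  cube_sphere_row z ord0 (lift ord0 j) = 2 * gap z * z j / denom z.
Proof. by rewrite mxE liftK. Qed.

Lemma sqnorm_ge0 z : 0 <= sqnorm z.
Proof. by apply: sumr_ge0 => j _; exact: sqr_ge0. Qed.

Lemma sqnorm_eq0 z : sqnorm z = 0 -> forall j, z j = 0.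
Proof.
move=> /eqP; rewrite psumr_eq0 => [/allP h j|j _]; last exact: sqr_ge0.
by have := h j (mem_index_enum _); rewrite /= sqrf_eq0 => /eqP.
Qed.

Lemma supnorm_ge0 z : 0 <= supnorm z.
Proof. by rewrite /supnorm; apply: bigmax_ge_id. Qed.

Lemma supnormZ (c : R) z : 0 <= c -> supnorm (fun j => c * z j) = c * supnorm z.
Proof.
move=> c0; rewrite /supnorm -bigmaxZ //.
by apply: eq_bigr => j _; rewrite normrM ger0_norm.
Qed.

(** The first summand vanishes only at the origin, where the gap is 1. *)
Lemma denom_gt0 z : 0 < denom z.
Proof.
rewrite lt_neqAle addr_ge0 ?sqnorm_ge0 ?sqr_ge0 // andbT eq_sym /denom.
rewrite paddr_eq0 ?sqnorm_ge0 ?sqr_ge0 //; apply/negP => /andP[/eqP/sqnorm_eq0 z0].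
rewrite sqrf_eq0 => /eqP; rewrite /gap => g0.
have : supnorm z <= 0 by apply: bigmax_le => // j _; rewrite z0 normr0.
by move=> h; lra.
Qed.

Lemma cube_sphere_subproof z : cube_sphere_row z \in sphere_set (R := R) (k := k).
Proof.
have d0 : denom z != 0 by rewrite gt_eqF // denom_gt0.
rewrite inE /sphere_set /= big_ord_recl cube_sphere_row0.
rewrite (eq_bigr (fun j => (2 * gap z / denom z) ^+ 2 * z j ^+ 2)) => [|j _].
  rewrite -mulr_sumr -/(sqnorm z); move: d0; rewrite /denom => d0.
  by field.
by rewrite cube_sphere_rowS -exprMn; congr (_ ^+ 2); ring.
Qed.

Definition cube_sphere z : sphere R k :=
  exist (fun x => x \in sphere_set (R := R) (k := k)) _ (cube_sphere_subproof z).

Lemma cts_sqnorm : continuous sqnorm.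
Proof. by apply: cts_sum => j _; apply: ctsM; exact: cts_coord. Qed.

Lemma cts_gap : continuous gap.
Proof.
apply: ctsB; first exact: ctsC.
by apply: cts_bigmax => j _; apply: cts_norm; exact: cts_coord.
Qed.

Lemma cts_denom : continuous denom.
Proof. by apply: ctsD; [exact: cts_sqnorm|apply: ctsM; exact: cts_gap]. Qed.

Lemma cts_cube_sphere : continuous cube_sphere.
Proof.
apply: (@continuous_comp_initial _ _ _ set_val).
have -> : set_val \o cube_sphere = cube_sphere_row by apply: funext.
have cVden : continuous (fun z => (denom z)^-1).
  by apply: ctsV => [z|]; [rewrite gt_eqF // denom_gt0|exact: cts_denom].
apply: mx_continuous => i j; rewrite ord1.
case: (unliftP ord0 j) => [l|] ->.
  rewrite (_ : (fun z => _) = fun z => 2 * gap z * z l / denom z); last first.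
    by apply: funext => z; exact: cube_sphere_rowS.
  apply: ctsM => //; apply: ctsM; last exact: cts_coord.
  by apply: ctsM; [exact: ctsC|exact: cts_gap].
rewrite (_ : (fun z => _) = fun z => (sqnorm z - gap z ^+ 2) / denom z); last first.
  by apply: funext => z; exact: cube_sphere_row0.
apply: ctsM => //; apply: ctsB; first exact: cts_sqnorm.
by apply: ctsM; exact: cts_gap.
Qed.

(** The first coordinate is 1 exactly when the squared gap vanishes, and the factor [gap z] then
    kills the other coordinates. *)
Lemma cube_sphere_base z : cube_sphere z = sphere_base R k <-> gap z = 0.
Proof.
have d0 : denom z != 0 by rewrite gt_eqF // denom_gt0.
split=> [/(congr1 val)/rowP/(_ ord0)|g0].
  rewrite /= cube_sphere_row0 mxE !eqxx /= => /(congr1 (fun x => x * denom z)).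
  rewrite mul1r divfK // /denom => h; apply/eqP; rewrite -sqrf_eq0; apply/eqP.
  by move: h; lra.
apply/val_inj/rowP => i; rewrite /=; case: (unliftP ord0 i) => [j|] ->.
  by rewrite cube_sphere_rowS g0 mulr0 !mul0r mxE eqxx eq_sym (negPf (neq_lift _ _)).
by rewrite cube_sphere_row0 mxE !eqxx g0 expr0n subr0 /= -[RHS](divff d0) /denom g0 expr0n addr0.
Qed.

(** The first coordinate determines the quotient of the squared gap by the denominator, and the
    others then show that z and z' are proportional in the ratio of their gaps. As the sup norm is 1
    minus the gap, this ratio is 1. *)
Lemma cube_sphere_inj z z' : 0 < gap z -> 0 < gap z' ->
  cube_sphere z = cube_sphere z' -> z = z'.
Proof.
move=> g0 g0' /(congr1 val)/rowP zz'.
have d0 : denom z != 0 by rewrite gt_eqF // denom_gt0.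
have d0' : denom z' != 0 by rewrite gt_eqF // denom_gt0.
have gn : gap z != 0 by rewrite gt_eqF.
have gn' : gap z' != 0 by rewrite gt_eqF.
have e0 : gap z ^+ 2 / denom z = gap z' ^+ 2 / denom z'.
  have := zz' ord0; rewrite /= !cube_sphere_row0 => h.
  have e y (yn : denom y != 0) : gap y ^+ 2 / denom y = (1 - (sqnorm y - gap y ^+ 2) / denom y) / 2.
    by move: yn; rewrite /denom => yn; field.
  by rewrite !e // h.
have ej j : z j = gap z / gap z' * z' j.
  have := zz' (lift ord0 j); rewrite /= !cube_sphere_rowS => h.
  have e y (yn : denom y != 0) (gy : gap y != 0) :
      y j = gap y * (2 * gap y * y j / denom y) / (2 * (gap y ^+ 2 / denom y)).
    by field; rewrite yn gy.
  by rewrite (e z) // (e z') // h e0; field; rewrite d0' gn'.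
have zE : z = (fun j => gap z / gap z' * z' j) by apply: funext.
have gg : gap z = gap z'.
  have : supnorm z = gap z / gap z' * supnorm z'.
    by rewrite {1}zE supnormZ // divr_ge0 ?ltW.
  have e y : supnorm y = 1 - gap y by rewrite /gap; ring.
  rewrite !e mulrBr mulr1 divfK // => h.
  have : gap z / gap z' = 1 by lra.
  by move=> h1; rewrite -[LHS](divfK gn') h1 mul1r.
by rewrite zE gg divff //; apply: funext => j; rewrite mul1r.
Qed.

(** Stereographic projection of p gives [v]. With m the sup norm of [v], the point z = v / (1 + m)
    has gap 1 / (1 + m), so that z / gap z = v. *)
Lemma cube_sphere_surj (p : sphere R k) : p <> sphere_base R k ->
  exists2 z, 0 < gap z & cube_sphere z = p.
Proof.
case: p => p pS pN; have pE : \sum_i p ord0 i ^+ 2 = 1 by have := pS; rewrite inE.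
pose v : T := fun j => p ord0 (lift ord0 j) / (1 - p ord0 ord0).
have sE : \sum_j p ord0 (lift ord0 j) ^+ 2 = 1 - p ord0 ord0 ^+ 2.
  by rewrite -pE big_ord_recl; ring.
have p1 : p ord0 ord0 != 1.
  apply/eqP => p1; apply: pN; apply/val_inj/rowP => i /=.
  rewrite mxE eqxx; case: (unliftP ord0 i) => [j|] -> /=; last first.
    by rewrite p1.
  apply: (@sqnorm_eq0 (fun j => p ord0 (lift ord0 j))).
  by rewrite /sqnorm sE p1; ring.
have q0 : 1 - p ord0 ord0 != 0 by rewrite subr_eq0 eq_sym.
have q2 : 1 + p ord0 ord0 <= 2.
  have : 0 <= \sum_j p ord0 (lift ord0 j) ^+ 2 by apply: sumr_ge0 => j _; exact: sqr_ge0.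
  by rewrite sE => h; nra.
set m := supnorm v; have m0 : 0 <= m := supnorm_ge0 v.
have m1 : 1 + m != 0 by rewrite gt_eqF //; lra.
pose z : T := fun j => (1 + m)^-1 * v j.
have gz : gap z = (1 + m)^-1.
  by rewrite /gap supnormZ ?invr_ge0 ?addr_ge0 // -/m; field.
have sz : sqnorm z = (1 + m)^-1 ^+ 2 * ((1 + p ord0 ord0) / (1 - p ord0 ord0)).
  rewrite /sqnorm (eq_bigr (fun j => ((1 + m)^-1 / (1 - p ord0 ord0)) ^+ 2 * p ord0 (lift ord0 j) ^+ 2)).
    by rewrite -mulr_sumr sE; field; rewrite m1 q0.
  by move=> j _; rewrite /z /v -exprMn; congr (_ ^+ 2); ring.
have dz : denom z = (1 + m)^-1 ^+ 2 * (2 / (1 - p ord0 ord0)).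
  by rewrite /denom sz gz; field; rewrite m1 q0.
exists z; first by rewrite gz invr_gt0; lra.
apply/val_inj/rowP => i /=; case: (unliftP ord0 i) => [j|] ->.
  by rewrite cube_sphere_rowS gz dz /z /v; field; rewrite m1 q0.
by rewrite cube_sphere_row0 sz gz dz; field; rewrite m1 q0.
Qed.

Lemma supnorm_lt z (c : R) : 0 < c -> (forall j, `|z j| < c) <-> supnorm z < c.
Proof.
move=> c0; split=> [h|h j]; first by apply: bigmax_lt.
exact: le_lt_trans (le_bigmax _ _ _) h.
Qed.

Lemma supnorm_le z (c : R) : 0 <= c -> (forall j, `|z j| <= c) -> supnorm z <= c.
Proof. by move=> c0 h; apply: bigmax_le. Qed.

End CubeToSphere.

Lemma sphere_hausdorff (R : realType) k : hausdorff_space (sphere R k).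
Proof.
apply: (@inj_hausdorff _ _ (set_val : sphere R k -> 'rV[R]_k.+1)).
- exact: initial_continuous.
- exact: val_inj.
- exact: norm_hausdorff.
Qed.

(** * The cubical model of the neighbourhood complex *)

Section NeighborhoodComplex.
Variables (R : realType) (k : nat).
Local Notation I := 'I_(k + 4).
Local Notation V := (kneser2_vertex k).
Local Notation T := {ptws I -> R}.
Local Notation word := {ffun I -> option bool}.
Local Notation N := (nbhd_complex (KG2 k)).
Implicit Types (e : V) (i j l m : I).

Definition slab : pred word := fun w => in_slab 2 2 [seq w i | i <- enum I].

Lemma count_letter (w : word) b :
  count_mem (Some b) [seq w i | i <- enum I] = #|[pred i | w i == Some b]|.
Proof. by rewrite count_map enumT cardE /enum_mem size_filter; exact: eq_count. Qed.

Lemma slabP (w : word) : slab w <->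
  (exists i j, [/\ i != j, w i = Some false & w j = Some false]) /\
  (exists i j, [/\ i != j, w i = Some true & w j = Some true]).
Proof.
rewrite /slab /in_slab /zeros /ones !count_letter.
have H b : (1 < #|[pred i | w i == Some b]|)%N <->
    exists i j, [/\ i != j, w i = Some b & w j = Some b].
  split=> [/card_gt1P[i [j [/eqP wi /eqP wj ij]]]|[i [j [ij wi wj]]]].
    by exists i, j.
  by apply/card_gt1P; exists i, j; rewrite !inE wi wj eqxx.
by split=> [/andP[/H ? /H ?]|[/H ? /H ?]]; [|apply/andP].
Qed.

Lemma face_closed_slab : face_closed slab.
Proof.
move=> w w' /refinesP ww' /slabP[[i [j [ij wi wj]]] [i' [j' [ij' wi' wj']]]].
by apply/slabP; split; [exists i, j|exists i', j']; split;
  rewrite ?(ww' _ _ wi) ?(ww' _ _ wj) ?(ww' _ _ wi') ?(ww' _ _ wj').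
Qed.

Definition model : topologicalType := set_type (cpx (R := R) slab).

Lemma edge_exists (i j : I) : i != j -> exists e : V, val e = [set i; j]%SET.
Proof.
move=> ij; have ij2 : #|[set i; j]%SET| == 2%N by rewrite cards2 ij.
by exists (Sub [set i; j]%SET ij2).
Qed.

Lemma edge_ends (e : V) : exists i j : I, i != j /\ val e = [set i; j]%SET.
Proof. by have /cards2P[i [j [ij eE]]] := valP e; exists i, j. Qed.

Definition top (x : {ptws V -> R}) : R := \big[Num.max/0]_e x e.
Definition top_at (x : {ptws V -> R}) (i : I) : R :=
  \big[Num.max/0]_(e : V | i \in val e) x e.
Definition coords (x : {ptws V -> R}) : T := fun i => top_at x i / top x.

Definition edge_prod (y : T) (e : V) : R := \prod_(i in val e) y i.
Definition total (y : T) : R := \sum_e edge_prod y e.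
Definition weights (y : T) : {ptws V -> R} := fun e => (total y)^-1 * edge_prod y e.

Local Notation real_set := (realization_set (R := R) N).

(** A common neighbour of the support is a pair disjoint from every pair of nonzero weight. *)
Lemma realP (x : {ptws V -> R}) : real_set x <->
  [/\ forall e, 0 <= x e, \sum_e x e = 1 &
    exists i j : I, i != j /\
      forall e : V, x e != 0 -> i \notin val e /\ j \notin val e].
Proof.
split=> [[x0 x1]|[x0 x1 [i [j [ij h]]]]].
  rewrite inE => /existsP[w /forall_inP h]; split => //.
  have [i [j [ij wE]]] := edge_ends w; exists i, j; split => // e xe.
  have := h e; rewrite inE => /(_ xe); rewrite /= /kneser2_adj => /eqP /setP ew.
  by split; [move: (ew i)|move: (ew j)]; rewrite !inE wE !inE eqxx ?orbT ?andbT => ->.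
split => //; rewrite inE; apply/existsP.
have [w wE] := edge_exists ij; exists w; apply/forall_inP => e.
rewrite inE => /h[ie je]; rewrite /= /kneser2_adj; apply/eqP/setP => l.
rewrite !inE wE !inE; apply/negP => /andP[le /orP[]/eqP lE].
  by rewrite -lE le in ie.
by rewrite -lE le in je.
Qed.

Lemma top_gt0 x : real_set x -> 0 < top x.
Proof.
move=> /realP[x0 x1 _]; rewrite ltNge; apply/negP => t0.
have : \sum_e x e = 0.
  apply: big1 => e _; apply/eqP; rewrite eq_le x0 andbT.
  exact: le_trans (le_bigmax _ _ _) t0.
by rewrite x1 => /eqP; rewrite oner_eq0.
Qed.

Lemma top_at_ge0 x i : 0 <= top_at x i.
Proof. by apply: bigmax_ge_id. Qed.

Lemma top_at_le x i : top_at x i <= top x.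
Proof.
apply: bigmax_le => [|e _]; first exact: bigmax_ge_id.
exact: le_bigmax.
Qed.

Lemma le_top_at x i (e : V) : i \in val e -> x e <= top_at x i.
Proof. by move=> ie; apply: (le_bigmax_cond _ x ie). Qed.

Lemma top_at_eq0 x i : (forall e, 0 <= x e) ->
  (forall e : V, x e != 0 -> i \notin val e) -> top_at x i = 0.
Proof.
move=> x0 h; apply/eqP; rewrite eq_le top_at_ge0 andbT.
apply: bigmax_le => // e ie; case: (eqVneq (x e) 0) => [->//|/h].
by rewrite ie.
Qed.

Lemma coords_eq0 x (i : I) : (forall e, 0 <= x e) ->
  (forall e : V, x e != 0 -> i \notin val e) -> coords x i = 0.
Proof. by move=> x0 h; rewrite /coords top_at_eq0 ?mul0r. Qed.

(** The two missed points give coordinates 0, and the two ends of an edge of maximal weight give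
    coordinates 1. *)
Lemma coords_model x : real_set x -> cpx slab (coords x).
Proof.
move=> xr; have t0 := top_gt0 xr; have /realP[x0 x1 [i [j [ij h]]]] := xr.
split=> [l|].
  by rewrite /coords divr_ge0 ?top_at_ge0 ?(ltW t0) //= ler_pdivrMr // mul1r top_at_le.
apply/slabP; split.
  by exists i, j; split => //; apply/(carP _ _ false); apply: coords_eq0 => // e /h[].
have [e0 _] := edge_exists ij.
have [e _ eM] : exists2 e : V, true & forall e', x e' <= x e.
  by case: (@arg_maxP _ R V e0 predT x) => // e _ eM; exists e => // e'; exact: eM.
have tE : top x = x e by apply/le_anti; rewrite le_bigmax bigmax_le.
have [l [m [lm eE]]] := edge_ends e.
have le : l \in val e by rewrite eE !inE eqxx.
have me : m \in val e by rewrite eE !inE eqxx orbT.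
exists l, m; split => //; apply/(carP _ _ true); rewrite /coords.
  rewrite (_ : top_at x l = top x) ?divff ?gt_eqF //.
  by apply/le_anti; rewrite top_at_le tE le_top_at.
rewrite (_ : top_at x m = top x) ?divff ?gt_eqF //.
by apply/le_anti; rewrite top_at_le tE le_top_at.
Qed.

Lemma edge_prod_ge0 (y : T) e : cube y -> 0 <= edge_prod y e.
Proof. by move=> yc; apply: prodr_ge0 => i _; have /andP[] := yc i. Qed.

Lemma edge_prod_le (y : T) e i : cube y -> i \in val e -> edge_prod y e <= y i.
Proof.
move=> yc ie; rewrite /edge_prod (bigD1 i) //=; have /andP[y0 _] := yc i.
by rewrite ler_piMr //; apply: prodr_ile1 => j _; exact: yc.
Qed.

Lemma edge_prod2 (y : T) (e : V) i j : i != j -> val e = [set i; j]%SET ->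
  edge_prod y e = y i * y j.
Proof. by move=> ij eE; rewrite /edge_prod eE big_setU1 ?big_set1 //= inE. Qed.

Lemma modelP (y : T) : cpx slab y <-> [/\ cube y,
  (exists i j, [/\ i != j, y i = 0 & y j = 0]) &
  (exists i j, [/\ i != j, y i = 1 & y j = 1])].
Proof.
split=> [[yc /slabP[[i [j [ij /carP i0 /carP j0]]] [l [m [lm /carP l1 /carP m1]]]]]|].
  by split => //; [exists i, j|exists l, m].
move=> [yc [i [j [ij i0 j0]]] [l [m [lm l1 m1]]]]; split => //; apply/slabP.
split; first by exists i, j; split => //; apply/(carP _ _ false).
by exists l, m; split => //; apply/(carP _ _ true).
Qed.

Lemma total_gt0 (y : T) : cpx slab y -> 0 < total y.
Proof.
move=> /modelP[yc _ [l [m [lm l1 m1]]]].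
have [e eE] := edge_exists lm.
rewrite /total (bigD1 e) //= (edge_prod2 _ lm eE) l1 m1 mul1r.
by rewrite ltr_pwDl //; apply: sumr_ge0 => e' _; exact: edge_prod_ge0.
Qed.

Lemma weights_neq0 (y : T) e i : weights y e != 0 -> i \in val e -> y i != 0.
Proof.
move=> + ie; apply: contra => /eqP yi.
by rewrite /weights /edge_prod (bigD1 i) //= yi mul0r mulr0.
Qed.

(** Every edge through one of the two zeros of y gets weight 0, so the support misses both. *)
Lemma weights_real (y : T) : cpx slab y -> real_set (weights y).
Proof.
move=> yY; have t0 := total_gt0 yY; have /modelP[yc [i [j [ij i0 j0]]] _] := yY.
apply/realP; split.
- by move=> e; rewrite mulr_ge0 ?edge_prod_ge0 // invr_ge0 ltW.
- by rewrite -mulr_sumr mulVf // gt_eqF.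
- exists i, j; split => // e we; split; apply/negP => /(weights_neq0 we).
    by rewrite i0 eqxx.
  by rewrite j0 eqxx.
Qed.

(** The largest product is 1, attained by two coordinates equal to 1. The largest product at i is
    y_i, attained by joining i to a coordinate 1 other than itself; that there are two of them is
    essential here. *)
Lemma weightsK (y : T) : cpx slab y -> coords (weights y) = y.
Proof.
move=> yY; have t0 := total_gt0 yY; have /modelP[yc _ [l [m [lm l1 m1]]]] := yY.
apply: funext => i; rewrite /coords /top_at /top !bigmaxZ ?invr_ge0 ?ltW //.
rewrite -mulf_div divff ?invr_eq0 ?gt_eqF // mul1r.
have -> : \big[Num.max/0]_e edge_prod y e = 1.
  apply/le_anti/andP; split.
    apply: bigmax_le => // e _; have [a [b [ab eE]]] := edge_ends e.
    apply: le_trans (edge_prod_le yc (_ : a \in val e)) _.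
      by rewrite eE !inE eqxx.
    by have /andP[] := yc a.
  have [e eE] := edge_exists lm.
  by rewrite -[leLHS](mul1r 1) -{1}l1 -m1 -(edge_prod2 y lm eE) le_bigmax.
rewrite divr1; apply/le_anti/andP; split.
  apply: bigmax_le => [|e ie]; first by have /andP[] := yc i.
  exact: edge_prod_le.
have [j ij j1] : exists2 j, i != j & y j = 1.
  have [il|il] := eqVneq i l; last by exists l.
  by exists m; rewrite // il.
have [e eE] := edge_exists ij.
rewrite -[leLHS]mulr1 -j1 -(edge_prod2 y ij eE).
have ie : i \in val e by rewrite eE !inE eqxx.
exact: (le_bigmax_cond _ (edge_prod y) ie).
Qed.

Definition real_coords (x : realization R N) : model :=
  exist (fun y => y \in cpx slab) _ (mem_set (coords_model (set_valP x))).

Definition real_weights (y : model) : realization R N :=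
  exist (fun x => x \in real_set) _ (mem_set (weights_real (set_valP y))).

Lemma cts_real_coords : continuous real_coords.
Proof.
apply: (@continuous_comp_initial _ _ _ set_val).
have cv : continuous (set_val : realization R N -> {ptws V -> R}).
  exact: initial_continuous.
apply: ptws_continuous => i.
apply: (@ctsM R _ (fun x : realization R N => top_at (val x) i)
   (fun x => (top (val x))^-1)).
  by apply: cts_bigmax => e _; exact: (@cts_coord_comp R (realization R N) V e set_val cv).
apply: ctsV => [x|]; first by rewrite gt_eqF //; apply: top_gt0; exact: set_valP.
by apply: cts_bigmax => e _; exact: (@cts_coord_comp R (realization R N) V e set_val cv).
Qed.

Lemma cts_real_weights : continuous real_weights.
Proof.
apply: (@continuous_comp_initial _ _ _ set_val).
have cv : continuous (set_val : model -> T) by exact: initial_continuous.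
have ce e : continuous (fun y : model => edge_prod (val y) e).
  by apply: cts_prod => i _; exact: (@cts_coord_comp R model I i set_val cv).
apply: ptws_continuous => e.
apply: (@ctsM R _ (fun y : model => (total (val y))^-1)
   (fun y => edge_prod (val y) e)) => //.
apply: ctsV => [y|]; first by rewrite gt_eqF //; apply: total_gt0; exact: set_valP.
by apply: cts_sum => e' _.
Qed.

Definition mix (x : {ptws V -> R}) (t : R) : {ptws V -> R} :=
  fun e => (1 - clamp t) * x e + clamp t * weights (coords x) e.

(** The segment stays in the realization: a point missed by the edges of x has coordinate 0, so the
    new weights miss it too. *)
Lemma mix_real x t : real_set x -> real_set (mix x t).
Proof.
move=> xr; have /realP[w0 w1 _] := weights_real (coords_model xr).
have /realP[x0 x1 [i [j [ij h]]]] := xr; apply/realP; split.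
- move=> e; apply: addr_ge0; apply: mulr_ge0 => //.
    by rewrite subr_ge0 clamp_le1.
  exact: clamp_ge0.
- transitivity ((1 - clamp t) * (\sum_(e : V) x e) +
    clamp t * \sum_(e : V) weights (coords x) e).
    by rewrite !mulr_sumr -big_split.
  by rewrite [X in _ * X + _]x1 [X in _ + _ * X]w1 !mulr1 subrK.
- exists i, j; split => // e mx; apply: contrapT => ije.
  have xe : x e = 0 by apply: contrapT => /eqP/h.
  move: mx; rewrite /mix xe mulr0 add0r mulf_eq0 negb_or => /andP[_ we].
  apply: ije; split; apply/negP => /(weights_neq0 we); rewrite coords_eq0 ?eqxx //.
    by move=> e' /h[].
  by move=> e' /h[].
Qed.

Lemma realization_model : homotopy_equivalent R (realization R N) model.
Proof.
exists real_coords, real_weights; split.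
- exact: cts_real_coords.
- exact: cts_real_weights.
- apply/homotopicP.
  pose H (z : realization R N * R) : realization R N :=
    exist (fun x => x \in real_set) _ (mem_set (mix_real (1 - z.2) (set_valP z.1))).
  exists H; split => //.
  + apply: continuous_cts_on; apply: (@continuous_comp_initial _ _ _ set_val).
    have cv : continuous (fun z : realization R N * R => set_val z.1 : {ptws V -> R}).
      by apply: (cts_comp (@cts_fst _ _)); exact: initial_continuous.
    have cw : continuous (fun z : realization R N * R =>
        set_val (real_weights (real_coords z.1)) : {ptws V -> R}).
      apply: (cts_comp (@cts_fst _ _) (g := fun x => set_val (real_weights (real_coords x)) : {ptws V -> R})).
      apply: (cts_comp cts_real_coords (g := fun x => set_val (real_weights x) : {ptws V -> R})).
      by apply: (cts_comp cts_real_weights); exact: initial_continuous.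
    have cc : continuous (fun z : realization R N * R => clamp (1 - z.2)).
      by apply: cts_clamp; apply: ctsB; [exact: ctsC|exact: cts_snd].
    apply: ptws_continuous => e.
    apply: (@ctsD R _ (fun z : realization R N * R => (1 - clamp (1 - z.2)) * (val z.1) e)
       (fun z => clamp (1 - z.2) * weights (coords (val z.1)) e)).
      apply: ctsM;
        last exact: (@cts_coord_comp R _ V e (fun z : realization R N * R => set_val z.1) cv).
      by apply: ctsB => //; exact: ctsC.
    by apply: ctsM => //;
      exact: (@cts_coord_comp R _ V e (fun z : realization R N * R => set_val (real_weights (real_coords z.1))) cw).
  + move=> x _; apply/val_inj/funext => e; rewrite /= /mix clamp_ge1; last by rewrite subr0.
    by rewrite subrr mul0r add0r mul1r.
  + move=> x _; apply/val_inj/funext => e; rewrite /= /mix clamp_le0; last by rewrite subrr.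
    by rewrite subr0 mul1r mul0r addr0.
(* This composite is the identity by [weightsK], and the constant homotopy suffices. *)
- apply/homotopicP; exists fst; split => //.
  + exact: cts_on_fst.
  + by move=> y _; apply/val_inj; rewrite /= weightsK //; exact: set_valP.
Qed.

End NeighborhoodComplex.

(** The wedge maps to the product of its summands, where points can be compared by coordinates. *)
Lemma wedge_lift_eq (I : choiceType) (X : I -> topologicalType)
    (p0 : forall i, X i) i j (a : X i) (b : X j) :
  wedge_lift p0 a = wedge_lift p0 b ->
  dfwith p0 a = dfwith p0 b.
Proof.
move=> /(congr1 (@wedge_prod _ _ p0)); rewrite /wedge_prod !wedge_lift_funE //.
all: exact: wedge_prod_pointE.
Qed.

Lemma card_enumeration (I : finType) (A : {pred I}) k : #|A| = k ->
  exists e : 'I_k -> I, [/\ injective e, forall n, e n \in A &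
    forall i, i \in A -> exists n, e n = i].
Proof.
move=> Ak; exists (fun n => enum_val (cast_ord (esym Ak) n)); split.
- by move=> n n' /enum_val_inj/cast_ord_inj.
- by move=> n; exact: enum_valP.
- move=> i iA; exists (cast_ord Ak (enum_rank_in iA i)).
  by rewrite cast_ordK enum_rankK_in.
Qed.

(** The inverse of the inclusion, completed by the value [p] outside [A], is continuous on [A] and
    maps it onto the subtype. *)
Lemma compact_set_type (X : topologicalType) (A : set X) (p : A) :
  compact A -> compact [set: A].
Proof.
move=> kA; pose g x : A :=
  if pselect (A x) is left Ax then exist (fun x => x \in A) x (mem_set Ax) else p.
have gE x : A x -> val (g x) = x by rewrite /g; case: pselect.
rewrite (_ : [set: A] = g @` A); last first.
  apply/seteqP; split=> // x _; exists (val x); first exact: set_valP.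
  by apply: val_inj; apply: gE; exact: set_valP.
apply: continuous_compact kA; apply: (@continuous_comp_initial _ _ _ set_val).
apply: (@subspace_eq_continuous _ _ _ (id : subspace A -> X)).
  by move=> x /set_mem /gE.
by apply: (@continuous_subspaceT X X A id) => x; exact: cvg_id.
Qed.

(** * Collapsing the model to a wedge of spheres *)

Section Collapse.
Variables (R : realType) (k : nat).
Local Notation I := 'I_(k + 4).
Local Notation T := {ptws I -> R}.
Local Notation word := {ffun I -> option bool}.
Local Notation m := (ncritical (k + 4) 2 2).
Local Notation slab := (@slab k).
Local Notation model := (model R k).
Implicit Types (w : word) (j : 'I_m) (y : T).

Definition spell w := [seq w i | i <- enum I].

Lemma size_spell w : size (spell w) = (k + 4)%N.
Proof. by rewrite size_map size_enum_ord. Qed.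

Lemma nth_spell w (i : I) : nth None (spell w) i = w i.
Proof. by rewrite (nth_map i) ?size_enum_ord // nth_ord_enum. Qed.

Lemma spell_inj : injective spell.
Proof. by move=> w w' ww'; apply/ffunP => i; rewrite -!nth_spell ww'. Qed.

Lemma refines_spell w w' : refines w w' -> all2 letter_refines (spell w) (spell w').
Proof.
move=> /refinesP ww'; rewrite /spell; elim: (enum I) => //= i s ->; rewrite andbT.
rewrite /letter_refines; case E: (w i) => [b|//].
by rewrite (ww' _ _ E) eqxx orbT.
Qed.

Definition critical_words := [seq l <- words (k + 4) | critical 2 2 l].

Lemma size_critical_words : size critical_words = m.
Proof. by rewrite size_filter. Qed.

Definition cell j : word := [ffun i : I => nth None (nth [::] critical_words j) i].

Lemma spell_cell j : spell (cell j) = nth [::] critical_words j.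
Proof.
have : nth [::] critical_words j \in critical_words.
  by rewrite mem_nth // size_critical_words.
rewrite mem_filter => /andP[_ /size_words sl].
apply: (@eq_from_nth _ None) => [|n]; first by rewrite size_spell sl.
by rewrite size_spell => nk; rewrite (nth_spell _ (Ordinal nk)) ffunE.
Qed.

Lemma critical_cell j : critical 2 2 (spell (cell j)).
Proof.
rewrite spell_cell.
have : nth [::] critical_words j \in critical_words.
  by rewrite mem_nth // size_critical_words.
by rewrite mem_filter => /andP[].
Qed.

Lemma cell_inj : injective cell.
Proof.
move=> j j' /(congr1 spell); rewrite !spell_cell => /eqP.
rewrite nth_uniq ?size_critical_words // => [/eqP/val_inj//|].
by rewrite filter_uniq // uniq_words.
Qed.

Lemma critical_is_cell w : critical 2 2 (spell w) -> exists j, w = cell j.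
Proof.
move=> cw; have wL : spell w \in critical_words.
  by rewrite mem_filter cw mem_words size_spell eqxx.
have iL : (index (spell w) critical_words < m)%N.
  by rewrite -size_critical_words index_mem.
exists (Ordinal iL); apply: spell_inj; by rewrite spell_cell nth_index.
Qed.

Lemma cell_slab j : slab (cell j).
Proof.
have := critical_count (critical_cell j).
by rewrite /slab /in_slab /spell => -[-> ->].
Qed.

(** Critical words all have the same numbers of zeros and ones, so none of these cells is a proper
    face of another. *)
Lemma refines_cell j w : refines (cell j) w -> critical 2 2 (spell w) -> w = cell j.
Proof.
move=> jw /critical_count[z o]; apply: spell_inj; symmetry.
have [_ _] := all2_refines_count (refines_spell jw); apply.
  by rewrite z; have [-> _] := critical_count (critical_cell j).
by rewrite o; have [_ ->] := critical_count (critical_cell j).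
Qed.

(** Of the k + 4 letters, two are 0 and two are 1; the critical cells have dimension k. *)
Lemma card_cell_stars j : #|[pred i | cell j i == None]| = k.
Proof.
have [z o] := critical_count (critical_cell j).
have s := size_spell (cell j).
have c : count_mem None (spell (cell j)) = #|[pred i | cell j i == None]|.
  by rewrite count_map enumT cardE /enum_mem size_filter; exact: eq_count.
have t l : (count_mem None l + zeros l + ones l = size l)%N.
  rewrite /zeros /ones; elim: l => [//|x l] /=.
  by move: (count _ l) (count _ l) (count _ l) => a b d; case: x => [[]|] /=; lia.
by move: (t (spell (cell j))); rewrite z o s c; lia.
Qed.

Definition star j := projT1 (cid (card_enumeration (card_cell_stars j))).

Lemma starP j : [/\ injective (star j), forall n, cell j (star j n) = None &
  forall i, cell j i = None -> exists n, star j n = i].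
Proof.
rewrite /star; case: cid => e [eI eN eS] /=; split => // [n|i iN].
  by move: (eN n); rewrite inE => /eqP.
by apply: eS; rewrite inE iN.
Qed.

(** Rescales the free coordinates of the cell from [0, 1] to [-1, 1], the cube that [cube_sphere]
    wraps around the sphere. *)
Definition chart j y : {ptws 'I_k -> R} := fun n => 2 * y (star j n) - 1.

Lemma cts_chart j : continuous (chart j).
Proof.
apply: ptws_continuous => n; apply: ctsB; last exact: ctsC.
by apply: ctsM; [exact: ctsC|exact: cts_coord].
Qed.

Lemma chart_interior j y : cube y -> car y = cell j -> 0 < gap (chart j y).
Proof.
move=> yc yj; rewrite /gap subr_gt0; apply/supnorm_lt => // n.
have [_ sN _] := starP j; have := sN n; rewrite -yj ffunE /letter.
case: eqP => // /eqP y0; case: eqP => // /eqP y1 _.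
have /andP[h0 h1] := yc (star j n).
have {}h0 : 0 < y (star j n) by rewrite lt_neqAle eq_sym y0.
have {}h1 : y (star j n) < 1 by rewrite lt_neqAle y1.
by rewrite /chart ltr_norml; apply/andP; split; lra.
Qed.

(** Some free coordinate of the cell is 0 or 1 at a boundary point, and the chart sends it to -1 or
    1. *)
Lemma chart_boundary j y : cube y -> refines (cell j) (car y) ->
  car y <> cell j -> gap (chart j y) = 0.
Proof.
move=> yc /refinesP jy yj.
have [i jN [b yb]] : exists2 i, cell j i = None & exists b, car y i = Some b.
  apply: contrapT => h; apply: yj; apply/ffunP => i.
  case ji: (cell j i) => [b|]; first exact: jy.
  by case yi: (car y i) => [b|//]; exfalso; apply: h; exists i => //; exists b.
have [_ _ sS] := starP j; have [n ni] := sS i jN.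
have : supnorm (chart j y) <= 1.
  apply: supnorm_le => // n'; rewrite /chart ler_norml.
  by have /andP[h0 h1] := yc (star j n'); apply/andP; split; lra.
have : 1 <= supnorm (chart j y).
  apply: le_trans (le_bigmax _ _ n); rewrite /chart ni.
  move/carP: yb => ->; case: b; rewrite /= ?mulr1 ?mulr0.
    by rewrite (_ : 2 - 1 = 1 :> R) ?normr1 //; ring.
  by rewrite sub0r normrN normr1.
by rewrite /gap => h1 h2; lra.
Qed.

(** The base point of the wedge is named through a summand, so one has to exist. *)
Lemma ncritical_gt0 : (0 < m)%N.
Proof. by rewrite ncritical22 addn_gt0 orbT. Qed.

Definition in_wedge j (p : sphere R k) : sphere_wedge R k m :=
  @wedge_lift _ (fun=> sphere R k) (fun=> sphere_base R k) j p.

Definition wedge_base : sphere_wedge R k m :=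
  in_wedge (Ordinal ncritical_gt0) (sphere_base R k).

Lemma in_wedge_base j : in_wedge j (sphere_base R k) = wedge_base.
Proof.
exact: (@wedge_liftE _ (fun=> sphere R k) (fun=> sphere_base R k)
  (Ordinal ncritical_gt0) (sphere_base R k) j (sphere_base R k)).
Qed.

Lemma in_wedge_inj j j' p p' : p <> sphere_base R k ->
  in_wedge j p = in_wedge j' p' -> j = j' /\ p = p'.
Proof.
move=> pN /wedge_lift_eq h.
have := congr1 (fun g => g j) h; rewrite dfwith_in => e.
have [jj|jj] := eqVneq j' j.
  by move: e; rewrite -jj dfwith_in.
by move: e; rewrite dfwith_out // => /pN.
Qed.

Definition collapse y : sphere_wedge R k m :=
  if [pick j | car y == cell j] is Some j then in_wedge j (cube_sphere (chart j y))
  else wedge_base.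

Local Notation spine := (collapsible_complex (enum I) [ffun=> None] 2 2).

(** With every coordinate listed in [enum I], the condition on the others is void. *)
Lemma spineE w : spine w = slab w && ~~ critical 2 2 (spell w).
Proof.
rewrite /collapsible_complex /off_face; rewrite [X in _ && X](_ : _ = true) ?andbT //.
by apply/forallP => i; rewrite mem_enum.
Qed.

(** The formula for the open cell persists on the closed one, as the boundary goes to the base
    point. This lets continuity be checked on closed pieces. *)
Lemma collapse_cell j y : cpx (refines (cell j)) y ->
  collapse y = in_wedge j (cube_sphere (chart j y)).
Proof.
move=> [yc jy]; rewrite /collapse; case: pickP => [j' /eqP yj'|h].
  suff -> : j' = j by [].
  apply: cell_inj; rewrite -yj'; apply: refines_cell => //.
  by rewrite yj'; exact: critical_cell.
have yj : car y <> cell j by move=> yj; have := h j; rewrite yj eqxx.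
have /cube_sphere_base -> := chart_boundary yc jy yj.
by rewrite in_wedge_base.
Qed.

Lemma collapse_spine y : spine (car y) -> collapse y = wedge_base.
Proof.
rewrite spineE /collapse => /andP[_ yN]; case: pickP => // j /eqP yj.
by move: yN; rewrite yj critical_cell.
Qed.

Lemma collapse_nonspine y : cube y -> slab (car y) -> ~~ spine (car y) ->
  exists j, [/\ car y = cell j, collapse y = in_wedge j (cube_sphere (chart j y)),
    0 < gap (chart j y) & cube_sphere (chart j y) <> sphere_base R k].
Proof.
move=> yc ys; rewrite spineE ys negbK => /critical_is_cell[j yj]; exists j.
have g0 := chart_interior yc yj; split => //.
  by apply: collapse_cell; split => //; rewrite yj refines_refl.
by move/cube_sphere_base => g; rewrite g ltxx in g0.
Qed.

Lemma face_closed_refines w : face_closed (refines w).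
Proof.
move=> u v /refinesP uv /refinesP wu; apply/refinesP => i b /wu; exact: uv.
Qed.

(** Pasting over the closed critical cells and the spine, which cover the model. *)
Lemma cts_collapse : cts_on (cpx slab) collapse.
Proof.
apply: (@cts_on_cover _ _ (option 'I_m)
  (fun o => if o is Some j then cpx (refines (cell j)) else cpx spine)).
- case=> [j|]; apply: closed_cpx; [exact: face_closed_refines|exact: face_closed_collapsible].
- move=> y [yc ys]; case: (boolP (spine (car y))) => sy; first by exists None.
  have [j [yj _ _ _]] := collapse_nonspine yc ys sy.
  by exists (Some j); split => //; rewrite yj refines_refl.
- case=> [j|].
    apply: (@eq_cts_on _ _ _ (fun y => in_wedge j (cube_sphere (chart j y)))).
      by move=> y [_ /collapse_cell].
    apply: continuous_cts_on; apply: (@cts_comp _ _ _ _ (in_wedge j)).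
      exact: (cts_comp (@cts_chart j) (@cts_cube_sphere R k)).
    exact: (@wedge_lift_continuous _ (fun=> sphere R k) (fun=> sphere_base R k)).
  apply: (@eq_cts_on _ _ _ (fun=> wedge_base)) => [y [_ [_ /collapse_spine]]//|].
  exact: cts_onC.
Qed.

(** An image other than the base point determines the sphere, hence the cell and its fixed
    coordinates, and then the free ones through the chart. *)
Lemma collapse_inj y y' : cpx slab y -> cpx slab y' -> collapse y = collapse y' ->
  y = y' \/ cpx spine y /\ cpx spine y'.
Proof.
move=> [yc ys] [yc' ys'] yy'.
case: (boolP (spine (car y))) => sy; case: (boolP (spine (car y'))) => sy'.
- by right.
- have [j [_ cE _ pN]] := collapse_nonspine yc' ys' sy'.
  move: yy'; rewrite collapse_spine // cE -(in_wedge_base j) => /esym.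
  by move=> /(in_wedge_inj pN)[_ /pN].
- have [j [_ cE _ pN]] := collapse_nonspine yc ys sy.
  move: yy'; rewrite [in RHS]collapse_spine // cE -(in_wedge_base j).
  by move=> /(in_wedge_inj pN)[_ /pN].
have [j [yj cE g0 pN]] := collapse_nonspine yc ys sy.
have [j' [yj' cE' g0' _]] := collapse_nonspine yc' ys' sy'.
left; move: yy'; rewrite cE cE' => /(in_wedge_inj pN)[jj]; subst j'.
move=> /(cube_sphere_inj g0 g0') yy; have [_ _ sS] := starP j.
apply: funext => i; case ji: (cell j i) => [b|].
  have /carP -> : car y i = Some b by rewrite yj.
  by have /carP -> : car y' i = Some b by rewrite yj'.
have [n <-] := sS i ji; have := congr1 (fun g => g n) yy; rewrite /chart => h.
by lra.
Qed.

Lemma collapse_surj (p : T) (W : sphere_wedge R k m) : cpx spine p ->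
  exists2 y, cpx slab y & collapse y = W.
Proof.
move=> [pc ps].
have : [set: sphere_wedge R k m] W by [].
rewrite -wedgeTE => -[j _ [q _ <-]].
have [->|/eqP qN] := eqVneq q (sphere_base R k).
  exists p; first by split => //; move: ps; rewrite spineE => /andP[].
  by rewrite collapse_spine //; symmetry; exact: in_wedge_base.
have [z g0 zq] := cube_sphere_surj qN.
have [sI sN sS] := starP j.
(* The inverse of the chart on the free coordinates, completed by the letters of the cell. *)
pose y : T := fun i => if [pick n | star j n == i] is Some n then (1 + z n) / 2
  else (cell j i == Some true)%:R.
have yE n : y (star j n) = (1 + z n) / 2.
  rewrite /y; case: pickP => [n' /eqP/sI ->//|/(_ n)]; by rewrite eqxx.
have zn : forall n, `|z n| < 1.
  by apply/(supnorm_lt z ltr01); rewrite -subr_gt0.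
have yb i b : cell j i = Some b -> y i = b%:R.
  move=> ji; rewrite /y; case: pickP => [n /eqP ni|_].
    by move: (sN n); rewrite ni ji.
  by rewrite ji; case: (b).
have yc : cube y.
  move=> i; case ji: (cell j i) => [b|]; first by rewrite (yb _ _ ji); case: b {ji};
    rewrite /= ?lexx ler01.
  have [n <-] := sS i ji; rewrite yE; have := zn n; rewrite ltr_norml => /andP[h1 h2].
  by apply/andP; split; lra.
have yj : car y = cell j.
  apply/ffunP => i; case ji: (cell j i) => [b|]; first by apply/carP; exact: yb.
  have [n <-] := sS i ji; rewrite ffunE yE /letter.
  have := zn n; rewrite ltr_norml => /andP[h1 h2].
  by rewrite !ifF //; apply/negbTE; rewrite neq_lt; apply/orP; [left|right]; lra.
exists y; first by split => //; rewrite yj cell_slab.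
rewrite (@collapse_cell j); last by split => //; rewrite yj refines_refl.
rewrite (_ : chart j y = z) ?zq //.
by apply: funext => n; rewrite /chart yE; field.
Qed.

Lemma model_wedge : homotopy_equivalent R model (sphere_wedge R k m).
Proof.
have kS : contracts (cpx (R := R) spine).
  by apply: contracts_collapsible; rewrite ?enum_uniq // size_enum_ord leq_addl.
have sS : subpred spine slab by move=> w; rewrite spineE => /andP[].
have fS := @face_closed_collapsible _ (enum I) [ffun=> None] 2 2.
(* The contraction of the spine extends to a deformation that preserves every larger subcomplex, in
   particular the model. *)
have [h [p [sp ch hS h0 h1]]] := contraction_extension fS kS.
have hY := hS _ (@face_closed_slab k) sS.
pose H (z : model * R) : model :=
  exist (fun y => y \in cpx slab) _ (mem_set (hY (val z.1) z.2 (set_valP z.1))).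
have spY : cpx slab p by have [pc /sS] := sp.
pose A := [set y : model | cpx spine (val y)].
pose f (y : model) := collapse (val y).
pose q : model := exist (fun y => y \in cpx slab) p (mem_set spY).
apply: (@collapse_equivalence R model (sphere_wedge R k m) A wedge_base f H q).
- by apply: (compact_set_type q); apply: compact_cpx; exact: face_closed_slab.
- apply: wedge_hausdorff => _; exact: sphere_hausdorff.
- apply: cts_onT; apply: (@cts_on_comp _ _ _ _ (cpx slab) (set_val : model -> T) collapse).
  + by apply: continuous_cts_on; exact: initial_continuous.
  + by move=> y _; exact: set_valP.
  + exact: cts_collapse.
- move=> W; have [y yY yW] := collapse_surj W sp.
  by exists (exist (fun y => y \in cpx slab) y (mem_set yY)).
- by move=> y [_ /collapse_spine].
- move=> y y' yy'; have [e|[? ?]] := collapse_inj (set_valP y) (set_valP y') yy'.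
    by left; apply: val_inj.
  by right.
- apply: (@continuous_comp_initial _ _ _ set_val); apply: cts_onT.
  apply: (cts_on_comp2 (f := fun z : model * R => set_val z.1) (g := snd) ch).
  + apply: continuous_cts_on; apply: (cts_comp (@cts_fst _ _)).
    exact: initial_continuous.
  + exact: cts_on_snd.
  + by move=> z _; split => //; have [] := set_valP z.1.
- by move=> y t sy; exact: hS _ _ _ _ _ sy.
- by move=> y; apply: val_inj; rewrite /= h0 //; have [] := set_valP y.
- by move=> y sy; apply: val_inj; rewrite /= h1.
Qed.

End Collapse.

Theorem theorem1p3 (R : realType) (k : nat) :
  homotopy_equivalent R
    (realization R (nbhd_complex (KG2 k)))
    (sphere_wedge R k (k ^ 2 + 5 * k + 5)).
Proof.
rewrite -ncritical22.
exact: homotopy_equivalent_trans (realization_model R k) (model_wedge R k).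
Qed.
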